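(* Let $\mathcal{X}$ be a radial tree with the measure $\mu$ and let $\mathcal{P}$ be the Bergman projector on $\mathcal{X}$, all as described in the context. Let $1<p<\infty$. If $w\in\tilde{\mathcal{B}}_p(\mu)$, then there is a constant $C$, depending only on $p$, $(\mathcal{X},\mu)$ and $[w]_{\tilde{\mathcal{B}}_p(\mu)}$, such that $$ \|\mathcal{P}f\|_{L^p(\mathcal{X},w)}\le C\,\|f\|_{L^p(\mathcal{X},w)}\qquad\text{for all } f\in L^p(\mathcal{X},w). $$
   Context: **Tree and measure.** $\mathcal{X}$ is an infinite tree (connected graph without cycles) with a distinguished vertex $0$ (origin), $d$ is the graph distance and $|x|=d(x,0)$. The number of children of $x$ (neighbours $y$ of $x$ with $|y|=|x|+1$) is denoted $q(x)$. $\mathcal{X}$ is radial: there is $\tilde q:\{0,1,2,\dots\}\to\{2,3,4,\dots\}$ with $q(x)=\tilde q(|x|)$ for all $x$ ($\tilde q$ may be unbounded). For $x\ne 0$, $x^{(1)}$ is the neighbour of $x$ with $|x^{(1)}|=|x|-1$, and $x^{(k)}$ is the $k$-th iterate. Fix $\alpha>1$ and let $\mu(\{x\})=c\prod_{\ell=0}^{|x|-1}\tilde q(\ell)^{-\alpha}$, with $c>0$ chosen so that $\mu(\mathcal{X})=1$. Functions are real-valued. For $Q\subseteq\mathcal{X}$, $\langle f\rangle_Q=\mu(Q)^{-1}\sum_{x\in Q}f(x)\mu(\{x\})$. **Dyadic sets.** The sector with vertex $x$ is $S_x=\{x\}\cup\{y: y^{(k)}=x\text{ for some }k\ge1\}$.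 $\mathscr{D}$ is the family of all sectors $S_x$ and all singletons $\{x\}$, $x\in\mathcal{X}$. The parent $Q^{(1)}$ of $Q\in\mathscr{D}$, $Q\neq\mathcal{X}=S_0$, is: $\{x\}^{(1)}=S_x$, and $S_x^{(1)}=S_{x^{(1)}}$ for $x\neq0$. **Bergman projector.** The combinatorial Laplacian is $\Delta f(x)=f(x)-\frac{1}{\#\{y:d(x,y)=1\}}\sum_{y:d(x,y)=1}f(y)$; $f$ is harmonic if $\Delta f=0$ on $\mathcal{X}$. The Bergman space $\mathcal{A}^2(\mathcal{X})$ is the closed subspace of harmonic functions in $L^2(\mathcal{X},\mu)$. $\mathcal{P}$ is the orthogonal projection of $L^2(\mathcal{X},\mu)$ onto $\mathcal{A}^2(\mathcal{X})$. It is given by $\mathcal{P}f(x)=\sum_y K(x,y)f(y)\mu(\{y\})$, where $K$ is the reproducing kernel of $\mathcal{A}^2(\mathcal{X})$; for each fixed $x$, $K(x,\cdot)$ is bounded, and $\mathcal{P}f$ is defined by this formula for $f\in L^1(\mathcal{X},\mu)$ (for $w\in\tilde{\mathcal B}_p(\mu)$ one has $L^p(\mathcal{X},w)\subseteq L^1(\mathcal{X},\mu)$). **Weights.** For $w:\mathcal{X}\to(0,\infty)$, $\|f\|_{L^p(\mathcal{X},w)}=\big(\sum_x|f(x)|^pw(x)\mu(\{x\})\big)^{1/p}$. With $\frac1p+\frac1{p'}=1$, $\tilde{\mathcal{B}}_p(\mu)$ is the class of $w:\mathcal{X}\to(0,\infty)$ such that $$ [w]_{\tilde{\mathcal{B}}_p(\mu)}:=\sup_{\substack{Q,R\in\mathscr{D}\setminus\{\mathcal{X}\}\\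 Q^{(1)}=R^{(1)}}}\langle w\rangle_Q\,\langle w^{-p'/p}\rangle_R^{p/p'}<\infty . $$ *)

(* Defs.v *)
From HB Require Import structures.
From mathcomp Require Import all_boot all_order all_algebra finmap.
From mathcomp Require Import all_classical all_reals all_analysis.

Set Implicit Arguments.
Unset Strict Implicit.
Unset Printing Implicit Defensive.

Import Order.TTheory GRing.Theory Num.Theory.

Local Open Scope classical_set_scope.
Local Open Scope ring_scope.

(* A graph is a symmetric irreflexive relation [adj] on a
   type [X] of vertices; the origin of a rooted tree is written [o]. *)

Definition walk_length (X : choiceType) (adj : rel X) (x y : X) : set nat :=
  [set n | exists s : seq X, [/\ path adj x s, last x s = y & size s = n]].

(* The default value 0 is only reached when no walk joins [x] and [y]. *)
Definition gdist (X : choiceType) (adj : rel X) (x y : X) : nat :=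
  xget 0%N [set n | walk_length adj x y n /\
                    forall m, walk_length adj x y m -> (n <= m)%N].

Definition level (X : choiceType) (adj : rel X) (o x : X) : nat :=
  gdist adj x o.

Definition children (X : choiceType) (adj : rel X) (o x : X) : set X :=
  [set y | adj x y /\ level adj o y = (level adj o x).+1].

(* In [rt_acyclic], [ucycle adj s] says that [s] lists without repetition the
   vertices of a closed walk; lists of length 2 run back and forth along an
   edge and are not cycles. *)
Record radial_tree (X : choiceType) (adj : rel X) (o : X) (q : nat -> nat) :
    Prop := RadialTree {
  rt_sym : symmetric adj;
  rt_irrefl : irreflexive adj;
  rt_connected : forall x y : X, exists n, walk_length adj x y n;
  rt_acyclic : forall s : seq X, (2 < size s)%N -> ~ ucycle adj s;
  rt_infinite : infinite_set [set: X];
  rt_q_ge2 : forall n, (2 <= q n)%N;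
  rt_radial : forall x : X, (children adj o x #= `I_(q (level adj o x)))%card
}.

(* By convention the origin, which has no predecessor, is sent to itself. *)
Definition pred_vertex (X : choiceType) (adj : rel X) (o x : X) : X :=
  xget x [set y | adj x y /\ (level adj o y).+1 = level adj o x].

(* The case k = 0 accounts for [x] itself.  The convention on the origin adds
   no vertex, since the iterates of [o] are all equal to [o]. *)
Definition sector (X : choiceType) (adj : rel X) (o x : X) : set X :=
  [set y | exists k, iter k (pred_vertex adj o) y = x].

Definition dyadic (X : choiceType) (adj : rel X) (o : X) : set (set X) :=
  [set Q | exists x, Q = sector adj o x \/ Q = [set x]].

(* [dyadic_parent adj o Q T] stands for Q^(1) = T. *)
Inductive dyadic_parent (X : choiceType) (adj : rel X) (o : X) :
    set X -> set X -> Prop :=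
| dyadic_parent_singleton x :
    dyadic_parent adj o [set x] (sector adj o x)
| dyadic_parent_sector x : x != o ->
    dyadic_parent adj o (sector adj o x)
                        (sector adj o (pred_vertex adj o x)).

Definition mass (R : realType) (X : choiceType) (adj : rel X) (o : X)
    (q : nat -> nat) (alpha c : R) (x : X) : R :=
  c * \prod_(l < level adj o x) (q l)%:R `^ (- alpha).

(* Signed sum of a real family over [A]; finite exactly when the family is absolutely
   summable on [A]. *)
Definition ssum (R : realType) (X : choiceType) (A : set X) (h : X -> R) :
    \bar R :=
  (\esum_(x in A) ((EFin \o h)^\+ x) - \esum_(x in A) ((EFin \o h)^\- x))%E.

Definition measure_of (R : realType) (X : choiceType) (mu : X -> R)
    (A : set X) : \bar R :=
  \esum_(x in A) (mu x)%:E.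

Definition average (R : realType) (X : choiceType) (mu : X -> R)
    (f : X -> R) (Q : set X) : \bar R :=
  (((fine (measure_of mu Q))^-1)%:E * ssum Q (fun x => (f x * mu x)%R))%E.

Definition Lpnorm (R : realType) (X : choiceType) (mu : X -> R) (p : R)
    (w f : X -> R) : \bar R :=
  poweR (\esum_(x in [set: X]) (`|f x| `^ p * w x * mu x)%:E) p^-1.

Definition Lp (R : realType) (X : choiceType) (mu : X -> R) (p : R)
    (w : X -> R) : set (X -> R) :=
  [set f | (Lpnorm mu p w f < +oo)%E].

Definition conj_exp (R : realType) (p : R) : R := (1 - p^-1)^-1.

Definition Bp_const (R : realType) (X : choiceType) (adj : rel X) (o : X)
    (mu : X -> R) (p : R) (w : X -> R) : \bar R :=
  let p' := conj_exp p in
  ereal_sup [set z | exists Q S T : set X,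
    [/\ dyadic adj o Q /\ Q <> [set: X],
        dyadic adj o S /\ S <> [set: X],
        dyadic_parent adj o Q T, dyadic_parent adj o S T &
        z = (average mu w Q *
             poweR (average mu (fun x => w x `^ (- (p' / p)))%R S) (p / p')%R)%E]].

Definition Bp (R : realType) (X : choiceType) (adj : rel X) (o : X)
    (mu : X -> R) (p : R) : set (X -> R) :=
  [set w | (forall x, 0 < w x) /\ (Bp_const adj o mu p w < +oo)%E].

Definition laplacian (R : realType) (X : choiceType) (adj : rel X)
    (f : X -> R) (x : X) : R :=
  let nbrs := [set y | gdist adj x y = 1%N] in
  f x - (#|` fset_set nbrs|%:R)^-1 * \sum_(y \in nbrs) f y.

Definition harmonic_fun (R : realType) (X : choiceType) (adj : rel X)
    (f : X -> R) : Prop :=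
  forall x, laplacian adj f x = 0.

Definition bergman_space (R : realType) (X : choiceType) (adj : rel X)
    (mu : X -> R) : set (X -> R) :=
  [set f | harmonic_fun adj f /\ Lp mu 2 (fun=> 1) f].

Definition inner (R : realType) (X : choiceType) (mu : X -> R)
    (f g : X -> R) : \bar R :=
  ssum [set: X] (fun y => f y * g y * mu y).

Definition reproducing_kernel (R : realType) (X : choiceType) (adj : rel X)
    (mu : X -> R) (K : X -> X -> R) : Prop :=
  (forall x, bergman_space adj mu (K x)) /\
  (forall f, bergman_space adj mu f ->
     forall x, (f x)%:E = inner mu f (K x)).

(* On L^2, [P] is the orthogonal projection onto the Bergman space; on L^1 it
   is given by integration against the reproducing kernel.  Since [mu] will be
   a probability measure, L^2 is contained in L^1 and [P] is thus determined
   on L^1; nothing is required of it outside L^1. *)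
Record bergman_projector (R : realType) (X : choiceType) (adj : rel X)
    (mu : X -> R) (P : (X -> R) -> (X -> R)) : Prop := BergmanProjector {
  bp_range : forall f, Lp mu 2 (fun=> 1) f -> bergman_space adj mu (P f);
  bp_orthogonal : forall f g, Lp mu 2 (fun=> 1) f -> bergman_space adj mu g ->
    inner mu (fun x => f x - P f x) g = 0%E;
  bp_kernel : exists2 K, reproducing_kernel adj mu K &
    forall f, Lp mu 1 (fun=> 1) f ->
      forall x, (P f x)%:E = ssum [set: X] (fun y => K x y * f y * mu y)
}.

(* Main.v *)
Require Import Defs.
From HB Require Import structures.
From mathcomp Require Import all_boot all_order all_algebra finmap.
From mathcomp Require Import all_classical all_reals all_analysis.
From mathcomp Require Import ring lra.

Set Implicit Arguments.
Unset Strict Implicit.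
Unset Printing Implicit Defensive.

Import Order.TTheory GRing.Theory Num.Theory.
Import numFieldNormedType.Exports.

Local Open Scope classical_set_scope.
Local Open Scope ring_scope.

(** The projector is integration against the reproducing kernel [K], and the
proof has two halves: a pointwise bound of [K] by averaging kernels over two
families of nested sets, and a weighted estimate for such averaging operators.

Kernel.  For two siblings [u], [u'] there is a harmonic function supported in
their two sectors, radial on each of them and of opposite sign
([harmonic_bump_sub]).  Pairing it with the harmonic function [K x] on the one
hand gives its value at [x], by the reproducing property; on the other hand a
harmonic function has radial averages on a sector that are determined by its
values at the vertex and at the parent of the vertex ([psum_harmonic]), so that
the pairing is a multiple of [K x u - K x u'] by a factor of at least the mass
of [u].  Hence [K x] separates siblings only if [x] lies below one of them
([kernel_siblings]).  Since harmonicity passes on at most half of the jump along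
an edge to the next edge, adding up the jumps along the path from the origin to
[y] gives [kernel_bound]: up to a factor 4, [|K x y|] is at most the sum of
[1 / mu v] over the sectors [S v] containing [x] and [y], plus the sum of
[1 / child_mass v] over the punctured sectors [S v] minus [v] containing both.

Weighted estimate.  Let [sigma] be the dual weight.  The sibling condition on
the pairs [{v}], [S u] with [u] a child of [v] shows that the [w]-mass of a
sector is comparable to that of its vertex, and likewise for [sigma].
Consequently the mass at distance [j] from the vertex decays geometrically in
[j] ([esum_sector_geometric]).  Comparability with the vertex also gives the
one-set condition on sectors; on punctured sectors that condition comes from the
pairs [S u], [S u'] of siblings.  For a family with this condition and geometric
decay, boundedness of the sum of all averages follows from Hölder's inequality
alone ([geometric_family_bound]): the decay pays for summing over the sets that
contain a given point. *)

(** * Powers and sums over arbitrary index sets *)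

Lemma powRN_lt1 (R : realType) (x t : R) : 1 < x -> 0 < t -> 0 < x `^ (- t) < 1.
Proof.
move=> x1 t0; have x0 : 0 < x by apply: lt_trans x1.
rewrite powR_gt0//= powRN invf_lt1 ?powR_gt0//.
have -> : (1 = 1 `^ t :> R) by rewrite powR1.
by apply: gt0_ltr_powR => //; rewrite nnegrE// ltW.
Qed.

Lemma powR_expn (R : realType) (x r : R) n : 0 <= x -> (x ^+ n) `^ r = (x `^ r) ^+ n.
Proof. by move=> x0; rewrite -powR_mulrn// powRAC powR_mulrn// powR_ge0. Qed.

Lemma conj_exp_div (R : realType) (p : R) : 1 < p -> conj_exp p / p = (p - 1)^-1.
Proof.
move=> p1; have p0 : 0 < p by lra.
have pm0 : 0 < p - 1 by lra.
by rewrite /conj_exp; field; rewrite !lt0r_neq0.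
Qed.

Lemma div_conj_exp (R : realType) (p : R) : 1 < p -> p / conj_exp p = p - 1.
Proof.
move=> p1; have p0 : 0 < p by lra.
have pm0 : 0 < p - 1 by lra.
by rewrite /conj_exp; field; rewrite !lt0r_neq0.
Qed.

Lemma poweR_addn_le (R : realType) (p : R) (a b : \bar R) : 0 < p ->
  (0 <= a)%E -> (0 <= b)%E ->
  (poweR (a + b) p <= (2 `^ p)%:E * (poweR a p + poweR b p))%E.
Proof.
move=> p0; wlog ab : a b / (a <= b)%E => [H|] a0 b0.
  have [ab|/ltW ba] := leP a b; first exact: H.
  by rewrite addeC [in leRHS]addeC; exact: H.
apply: (@le_trans _ _ (poweR (2%:E * b) p)).
  apply: gt0_ler_poweR; rewrite ?(ltW p0)// ?in_itv/= ?leey ?andbT ?adde_ge0//.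
    by rewrite mule_ge0// lee_fin.
  by rewrite -[2]/(1 + 1) EFinD ge0_muleDl// !mul1e leeD2r.
rewrite poweRM// ?lee_fin// poweR_EFin lee_wpmul2l ?lee_fin ?powR_ge0//.
by rewrite leeDr// poweR_ge0.
Qed.

Lemma seq_argmax (R : realType) (X : eqType) (s : seq X) (F : X -> R) :
  (exists u, u \in s) -> exists2 u, u \in s & forall u', u' \in s -> F u' <= F u.
Proof.
elim: s => [[u//]|x s IH _].
case: s IH => [_|y s IH].
  by exists x => [|u']; rewrite inE// => /eqP ->.
have [|u us umax] := IH; first by exists y; rewrite inE eqxx.
have [xu|ux] := leP (F x) (F u).
  by exists u => [|u']; rewrite inE ?us ?orbT// => /predU1P[->//|]; exact: umax.
exists x => [|u']; rewrite inE ?eqxx// => /predU1P[->//|/umax].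
by move=> /le_trans; apply; exact: ltW.
Qed.

Section Families.
Variables (R : realType) (X : choiceType).

Lemma funepos_EFin (F : X -> R) x : ((EFin \o F)^\+ x = (Num.max (F x) 0)%:E)%E.
Proof. by rewrite funeposE EFin_max. Qed.

Lemma funeneg_EFin (F : X -> R) x : ((EFin \o F)^\- x = (Num.max (- F x) 0)%:E)%E.
Proof. by rewrite funenegE EFin_max. Qed.

Lemma ssum_ge0 (A : set X) (F : X -> R) : (forall x, 0 <= F x) ->
  ssum A F = (\esum_(x in A) (F x)%:E)%E.
Proof.
move=> F0; rewrite /ssum [X in (_ - X)%E]esum1 ?sube0.
  by apply: eq_esum => x _; rewrite funepos_EFin (max_idPl _).
by move=> x _; rewrite funeneg_EFin (max_idPr _)// oppr_le0.
Qed.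

Lemma abs_ssum_le (A : set X) (F : X -> R) :
  (`|ssum A F| <= \esum_(x in A) `|F x|%:E)%E.
Proof.
rewrite /ssum.
set a := esum A _; set b := esum A _.
have a0 : (0 <= a)%E by apply: esum_ge0 => x _; rewrite funepos_EFin lee_fin le_max lexx orbT.
have b0 : (0 <= b)%E by apply: esum_ge0 => x _; rewrite funeneg_EFin lee_fin le_max lexx orbT.
apply: (@le_trans _ _ (a + b)%E).
  by rewrite (le_trans (lee_abs_sub _ _))// !gee0_abs.
rewrite -esumD; last 2 first.
- by move=> x _; rewrite funepos_EFin lee_fin le_max lexx orbT.
- by move=> x _; rewrite funeneg_EFin lee_fin le_max lexx orbT.
apply: le_esum => x _; rewrite funepos_EFin funeneg_EFin -EFinD lee_fin.
case/orP: (le_total 0 (F x)) => Fx.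
  by rewrite (max_idPl Fx) (max_idPr _) ?oppr_le0// addr0 ler_norm.
by rewrite (max_idPr Fx) (max_idPl _) ?oppr_ge0// add0r -normrN ler_norm.
Qed.

Lemma ssum_support (A : set X) (F : X -> R) : (forall y, ~ A y -> F y = 0) ->
  ssum [set: X] F = ssum A F.
Proof.
move=> F0; rewrite /ssum; congr (_ - _)%E.
- rewrite [RHS]esum_mkcond; apply: eq_esum => y _.
  case: ifPn => // /negP; rewrite inE => /F0 Fy.
  by rewrite funepos_EFin Fy maxxx.
- rewrite [RHS]esum_mkcond; apply: eq_esum => y _.
  case: ifPn => // /negP; rewrite inE => /F0 Fy.
  by rewrite funeneg_EFin Fy oppr0 maxxx.
Qed.

Lemma esum_ge_term (A : set X) (a : X -> \bar R) i :
  A i -> (a i <= \esum_(i in A) a i)%E.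
Proof.
move=> Ai; apply: esum_ge; exists [set i]; first by split => // _ ->.
by rewrite fsbig_set1.
Qed.

End Families.

Section Holder.
Variable R : realType.
Local Open Scope ereal_scope.

Lemma ge0_esumZl (I : choiceType) (A : set I) (c : R) (a : I -> \bar R) :
  (0 <= c)%R -> (forall i, A i -> 0 <= a i) ->
  \esum_(i in A) (c%:E * a i) = c%:E * \esum_(i in A) a i.
Proof.
have le (d : R) (b : I -> \bar R) : (0 <= d)%R -> (forall i, A i -> 0 <= b i) ->
    \esum_(i in A) (d%:E * b i) <= d%:E * \esum_(i in A) b i.
  move=> d0 b0; apply: ge_ereal_sup => _ [B [finB BA] <-].
  rewrite fsbig_finite//= big_seq -ge0_sume_distrr -?big_seq; last first.
    by move=> i; rewrite in_fset_set// => /set_mem iB; exact/b0/BA.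
  rewrite lee_wpmul2l ?lee_fin//; apply: esum_ge; exists B => //.
  by rewrite fsbig_finite.
move=> c0 a0; apply/eqP; rewrite eq_le le//=.
move: c0; rewrite [(0 <= c)%R]le_eqVlt => /orP[/eqP <-|c0].
  by rewrite mul0e esum_ge0// => i _; rewrite mul0e.
rewrite muleC -lee_pdivlMr// muleC.
have := le c^-1%R (fun i => c%:E * a i).
rewrite invr_ge0 (ltW c0) => /(_ isT) le'.
apply: le_trans (le' _); last by move=> i Ai; rewrite mule_ge0 ?lee_fin ?(ltW c0) ?a0.
apply: le_esum => i _; rewrite muleA -EFinM mulVf ?mul1e//; exact: lt0r_neq0.
Qed.

(** Tonelli's theorem, in the form that exchanges points and the sets containing
them. *)
Lemma esum_exchange (I J : choiceType) (r : I -> J -> Prop) (a : I -> J -> \bar R) :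
  (forall i j, 0 <= a i j) ->
  \esum_(i in [set: I]) \esum_(j in [set j | r i j]) a i j =
  \esum_(j in [set: J]) \esum_(i in [set i | r i j]) a i j.
Proof.
move=> a0.
rewrite esum_esum//; rewrite esum_esum//.
apply: (@reindex_esum _ _ _ _ _ (fun k => (k.2, k.1))) => //=; split.
- by move=> [j i] [_ /= ?]; split.
- by move=> [j i] [j' i'] _ _ /= [-> ->].
- by move=> [i j] [_ /= ?]; exists (j, i).
Qed.

(** Hölder's inequality; the bound on the second factor is a hypothesis because the
sum of the first is allowed to be infinite. *)
Lemma esum_holder (I : choiceType) (A : set I) (p : R) (a b : I -> R) (M : R) :
  (1 < p)%R -> (forall i, (0 <= a i)%R) -> (forall i, (0 <= b i)%R) -> (0 < M)%R ->
  \esum_(i in A) (b i `^ (p / (p - 1)))%:E <= M%:E ->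
  poweR (\esum_(i in A) (a i * b i)%:E) p <=
    (M `^ (p - 1))%:E * \esum_(i in A) (a i `^ p)%:E.
Proof.
move=> p1 a0 b0 M0 bM.
have p0 : (0 < p)%R by lra.
have pm0 : (0 < p - 1)%R by lra.
have p'0 : (0 < p / (p - 1))%R by rewrite divr_gt0.
have sA0 : 0 <= \esum_(i in A) (a i `^ p)%:E.
  by apply: esum_ge0 => i _; rewrite lee_fin powR_ge0.
have pM0 : (0 < M `^ (p - 1))%R by rewrite powR_gt0.
case: (leP +oo (\esum_(i in A) (a i `^ p)%:E)) => [|Afin].
  by rewrite leye_eq => /eqP ->; rewrite gt0_muley ?leey// lte_fin.
have [s sE] : exists s, \esum_(i in A) (a i `^ p)%:E = s%:E.
  by exists (fine (\esum_(i in A) (a i `^ p)%:E)); rewrite fineK// ge0_fin_numE.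
rewrite sE; rewrite sE lee_fin in sA0.
(* The inequality is proved with any [t] above the sum [s]; a positive [t] can be
used to normalise in Young's inequality, even if [s] is zero. *)
have key (t : R) : (s < t)%R -> poweR (\esum_(i in A) (a i * b i)%:E) p <=
    (M `^ (p - 1) * t)%:E.
  move=> st; have t0 : (0 < t)%R by apply: le_lt_trans st.
  (* Young's inequality is applied to [a i / al] and [b i / be]. *)
  pose al := (t `^ p^-1)%R; pose be := (M `^ ((p - 1) / p))%R.
  have al0 : (0 < al)%R by rewrite powR_gt0.
  have be0 : (0 < be)%R by rewrite powR_gt0.
  have alp : (al `^ p = t)%R by rewrite /al -powRrM mulVf ?powRr1 ?ltW// lt0r_neq0.
  have bep : (be `^ (p / (p - 1)) = M)%R.
    rewrite /be -powRrM; have -> : ((p - 1) / p * (p / (p - 1)) = 1)%R.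
      by field; rewrite !lt0r_neq0.
    by rewrite powRr1// ltW.
  have alV : (al^-1 `^ p = t^-1)%R.
    by rewrite -(powR_inv1 (ltW al0)) powRAC alp powR_inv1// ltW.
  have beV : (be^-1 `^ (p / (p - 1)) = M^-1)%R.
    by rewrite -(powR_inv1 (ltW be0)) powRAC bep powR_inv1// ltW.
  have le1 : \esum_(i in A) (a i * b i)%:E <= (al * be)%:E.
    apply: (@le_trans _ _ (\esum_(i in A) (((al * be * (p^-1 / t))%:E * (a i `^ p)%:E) +
      ((al * be * ((p - 1) / p / M))%:E * (b i `^ (p / (p - 1)))%:E)))).
      apply: le_esum => i _; rewrite -!EFinM -EFinD lee_fin.
      have := @conjugate_powR R (a i / al)%R (b i / be)%R p (p / (p - 1))%R.
      rewrite !divr_ge0 ?(ltW al0) ?(ltW be0)// => /(_ isT isT p0 p'0).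
      have -> : (p^-1 + (p / (p - 1))^-1 = 1)%R by field; rewrite !lt0r_neq0.
      move=> /(_ erefl); rewrite !powRM ?invr_ge0 ?(ltW al0) ?(ltW be0)//.
      rewrite alV beV.
      set x := (_ `^ p)%R; set y := (_ `^ (p / _))%R => H.
      have {}H := ler_wpM2l (ltW (mulr_gt0 al0 be0)) H.
      have -> : (a i * b i = al * be * (a i / al * (b i / be)))%R.
        by field; rewrite !lt0r_neq0.
      apply: (le_trans H); rewrite le_eqVlt; apply/orP; left; apply/eqP.
      by field; rewrite !lt0r_neq0.
    rewrite esumD; last 2 first.
    - move=> i _; rewrite -EFinM lee_fin !mulr_ge0// ?powR_ge0//; try exact: ltW.
      by rewrite invr_ge0 ltW.
      by rewrite invr_ge0 ltW.
    - move=> i _; rewrite -EFinM lee_fin !mulr_ge0// ?powR_ge0//; try exact: ltW.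
      by rewrite invr_ge0 ltW.
      by rewrite invr_ge0 ltW.
    have c1 : (0 <= al * be * (p^-1 / t))%R.
      by rewrite !mulr_ge0 ?invr_ge0// ltW.
    have c2 : (0 <= al * be * ((p - 1) / p / M))%R.
      by rewrite !mulr_ge0 ?invr_ge0// ltW.
    rewrite !ge0_esumZl//; try by move=> i _; rewrite lee_fin powR_ge0.
    rewrite sE.
    apply: (@le_trans _ _ ((al * be * (p^-1 / t))%:E * t%:E +
        (al * be * ((p - 1) / p / M))%:E * M%:E)).
      by apply: leeD; apply: lee_wpmul2l; rewrite ?lee_fin// ltW.
    rewrite -!EFinM -EFinD lee_fin le_eqVlt; apply/orP; left; apply/eqP.
    by field; rewrite !lt0r_neq0.
  have -> : (M `^ (p - 1) * t)%:E = poweR (al * be)%:E p.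
    have ex : ((p - 1) / p * p = p - 1)%R by field; rewrite lt0r_neq0.
    by rewrite poweR_EFin powRM ?ltW// alp /be -powRrM ex mulrC.
  apply: gt0_ler_poweR => //; first exact: ltW.
    rewrite in_itv/= leey andbT; apply: esum_ge0 => i _.
    by rewrite lee_fin mulr_ge0.
  by rewrite in_itv/= leey andbT lee_fin mulr_ge0// ltW.
rewrite -EFinM.
apply/lee_addgt0Pr => e e0; rewrite -EFinD.
apply: le_trans (key (s + e / M `^ (p - 1))%R _) _.
  by rewrite ltrDl divr_gt0.
rewrite lee_fin mulrDr lerD2l mulrC divfK ?lt0r_neq0//.
Qed.

End Holder.

(** * Rooted tree structure *)

Section Tree.
Variables (X : choiceType) (adj : rel X) (o : X) (q : nat -> nat).
Hypothesis T : radial_tree adj o q.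

Notation lev := (level adj o).
Notation par := (pred_vertex adj o).

Let symA : symmetric adj := rt_sym T.

Lemma gdistP x y :
  walk_length adj x y (gdist adj x y) /\
  forall m, walk_length adj x y m -> (gdist adj x y <= m)%N.
Proof.
have [n nw] := rt_connected T x y.
have ex : exists n, `[< walk_length adj x y n >] by exists n; apply/asboolP.
case: (ex_minnP ex) => m /asboolP mw mmin.
have : [set n | walk_length adj x y n /\
   forall m, walk_length adj x y m -> (n <= m)%N] m.
  by split=> // k kw; apply: mmin; apply/asboolP.
by move=> /(@xgetI _ 0%N).
Qed.

Lemma gdist_eq1 x y : (gdist adj x y = 1%N) <-> adj x y.
Proof.
have [[s [ps ls <-]] dmin] := gdistP x y; split.
  by case: s ps ls {dmin} => [|z [|//]] //= /andP[xz _] <-.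
move=> xy; have : walk_length adj x y 1 by exists [:: y]; rewrite /= xy.
move=> /dmin; case: s ps ls {dmin} => [_ /= exy|z [|//]//].
by move: xy; rewrite exy (rt_irrefl T).
Qed.

Lemma level_origin : lev o = 0%N.
Proof.
have [_ dmin] := gdistP o o.
have /dmin : walk_length adj o o 0 by exists [::].
by rewrite leqn0 => /eqP.
Qed.

Lemma level_eq0 x : (lev x == 0%N) = (x == o).
Proof.
apply/eqP/eqP => [|->]; last exact: level_origin.
rewrite /level; have [[s [ps ls <-]] _] := gdistP x o.
by case: s ps ls => //=.
Qed.

Lemma level_adj x y : adj x y -> (lev x <= (lev y).+1)%N.
Proof.
move=> xy; have [[s [ps ls sz]] _] := gdistP y o.
have [_ dmin] := gdistP x o.
by apply: dmin; exists (y :: s); split => //=; [rewrite xy|rewrite sz].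
Qed.

Lemma exists_down x : x != o -> exists2 y, adj x y & lev x = (lev y).+1.
Proof.
rewrite -level_eq0 => lx0.
have [[s [ps ls sz]] _] := gdistP x o.
case: s ps ls sz => [|y s] /= => [_ _ e|/andP[xy ps] ls sz].
  by rewrite /level -e in lx0.
exists y => //; apply/eqP; rewrite eqn_leq level_adj//=.
have [_ dmin] := gdistP y o.
by rewrite /level -sz ltnS; apply: dmin; exists s.
Qed.

Definition linked (e : rel X) (x y : X) := exists s, path e x s /\ last x s = y.

Lemma linked_trans e x y z : linked e x y -> linked e y z -> linked e x z.
Proof.
move=> [s [ps ls]] [t [pt lt]]; exists (s ++ t).
by rewrite cat_path ps ls last_cat ls.
Qed.

Lemma linked_sym e x y : symmetric e -> linked e x y -> linked e y x.
Proof.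
move=> se [s [ps <-]]; elim: s x ps => [|z s IH] x /=; first by exists [::].
move=> /andP[xz ps]; apply: linked_trans (IH _ ps) _.
by exists [:: x]; rewrite /= se xz.
Qed.

Definition cut_edge (x y : X) : rel X :=
  fun a b => [&& adj a b, (a, b) != (x, y) & (a, b) != (y, x)].

Lemma cut_edge_sym x y : symmetric (cut_edge x y).
Proof.
move=> a b; rewrite /cut_edge symA; congr (_ && _).
by rewrite !xpair_eqE andbC; congr (~~ _ && ~~ _); rewrite andbC.
Qed.

(** In a graph without cycles every edge is a bridge: a walk between its two
ends avoiding the edge could be shortened to a simple one, and the edge would
close it into a cycle. *)
Lemma edge_is_bridge x y : adj x y -> ~ linked (cut_edge x y) y x.
Proof.
move=> xy [s [ps ls]].
have xNy : x != y by apply: contraTneq xy => ->; rewrite (rt_irrefl T).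
case: (shortenP ps) ls => s' ps' us' _ ls.
case/lastP: s' ps' us' ls => [|t z] ps' us' ls.
  by move: ls xNy => /= ->; rewrite eqxx.
have ez : z = x by rewrite last_rcons in ls.
subst z.
case: t ps' us' ls => [|a t] ps' us' ls.
  by move: ps'; rewrite /= /cut_edge eqxx /= !andbF.
apply: (rt_acyclic T (s := y :: rcons (a :: t) x)); first by rewrite /= size_rcons.
rewrite /ucycle us' andbT; rewrite (cycle_path x) /= last_rcons xy /=.
have -> : adj y a by move: ps' => /= /andP[/and3P[]].
apply: sub_path (_ : path (cut_edge x y) a (rcons t x)).
  by move=> u v /and3P[].
by move: ps' => /= /andP[].
Qed.

Lemma linked_origin (e : rel X) n :
  (forall a b, adj a b -> lev a = (lev b).+1 -> (lev a <= n)%N -> e a b) ->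
  forall z, (lev z <= n)%N -> linked e z o.
Proof.
move=> He z; move lz : (lev z) => k; elim: k z lz => [|k IH] z lz kn.
  by exists [::]; split => //=; apply/eqP; rewrite -level_eq0 lz.
have z0 : z != o by rewrite -level_eq0 lz.
have [y zy ly] := exists_down z0.
apply: linked_trans (IH y _ (ltnW kn)); last by move: ly; rewrite lz => -[].
by exists [:: y]; rewrite /= He// lz.
Qed.

(** Descending walks join both ends of an edge to the origin, and they never use
an edge between vertices of equal level; so such an edge would not be a bridge. *)
Lemma level_adj_neq x y : adj x y -> lev x <> lev y.
Proof.
move=> xy exy; apply: (edge_is_bridge xy).
have He a b : adj a b -> lev a = (lev b).+1 -> (lev a <= lev x)%N ->
    cut_edge x y a b.
  move=> ab lab _; rewrite /cut_edge ab /=; apply/andP; split.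
    by apply/eqP => -[ea eb]; move: lab; rewrite ea eb exy; apply/n_Sn.
  by apply/eqP => -[ea eb]; move: lab; rewrite ea eb exy; apply/n_Sn.
apply: (@linked_trans _ _ o); first by apply: (linked_origin He); rewrite exy.
apply: linked_sym; first exact: cut_edge_sym.
exact: (linked_origin He).
Qed.

(** A second descending edge at [x] would give a walk from [x] to [y] through the
origin that avoids the first one. *)
Lemma down_unique x y z : adj x y -> adj x z -> lev x = (lev y).+1 ->
  lev x = (lev z).+1 -> y = z.
Proof.
move=> xy xz ly lz; apply/eqP/negPn/negP => yNz; apply: (edge_is_bridge xy).
have He a b : adj a b -> lev a = (lev b).+1 -> (lev a <= lev y)%N ->
    cut_edge x y a b.
  move=> ab lab lay; rewrite /cut_edge ab /=; apply/andP; split.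
    by apply/eqP => -[ea eb]; move: lay; rewrite ea ly ltnn.
  by apply/eqP => -[ea eb]; move: lab; rewrite ea eb ly => /eqP; rewrite -addn2 -[X in X == _]addn0 eqn_add2l.
apply: (@linked_trans _ _ o); first exact: (linked_origin He).
apply: linked_sym; first exact: cut_edge_sym.
apply: (@linked_trans _ _ z); last first.
  by apply: (linked_origin He); move: lz; rewrite ly => -[->].
exists [:: z]; split => //=; rewrite andbT /cut_edge xz/=; apply/andP; split.
  by rewrite xpair_eqE eqxx /= eq_sym.
by apply/eqP => -[ex _]; move: ly; rewrite ex; apply/n_Sn.
Qed.

Lemma parP x : x != o -> adj x (par x) /\ lev x = (lev (par x)).+1.
Proof.
move=> x0; have [y xy ly] := exists_down x0.
have : [set y | adj x y /\ (lev y).+1 = lev x] y by [].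
by move=> /(@xgetI _ x) -[] ? <-.
Qed.

Lemma par_origin : par o = o.
Proof.
by apply: xgetPN => y [_]; rewrite level_origin.
Qed.

Lemma level_par x : x != o -> lev x = (lev (par x)).+1.
Proof. by move=> /parP[]. Qed.

Lemma childrenP v y : children adj o v y <-> y != o /\ par y = v.
Proof.
split=> [[vy ly]|[y0 <-]].
  have y0 : y != o by rewrite -level_eq0 ly.
  have [yp lp] := parP y0; split => //.
  by apply: (@down_unique y) => //; rewrite symA.
by have [yp lp] := parP y0; split => //; rewrite symA.
Qed.

Lemma adjP x y : adj x y <-> children adj o x y \/ (x != o /\ par x = y).
Proof.
split=> [xy|[[]//|[x0 <-]]]; last by have [] := parP x0.
have l1 := level_adj xy; have l2 := level_adj (etrans (symA y x) xy).
have l3 := level_adj_neq xy.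
have [ly|ly] := ltnP (lev x) (lev y).
  by left; split => //; apply/eqP; rewrite eqn_leq l2.
right; apply/childrenP; split; first by rewrite symA.
by apply/eqP; rewrite eqn_leq l1 ltn_neqAle ly andbT eq_sym; apply/eqP.
Qed.

Definition ch (v : X) : seq X := fset_set (children adj o v).

Lemma finite_children v : finite_set (children adj o v).
Proof. by apply/finite_setP; exists (q (lev v)); apply: (rt_radial T). Qed.

Lemma mem_ch v u : (u \in ch v) = (u != o) && (par u == v).
Proof.
rewrite /ch in_fset_set; last exact: finite_children.
apply/idP/idP => [/set_mem/childrenP[-> ->]|/andP[u0 /eqP pu]].
  by rewrite eqxx.
exact/mem_set/childrenP.
Qed.

Lemma uniq_ch v : uniq (ch v).
Proof. exact: fset_uniq. Qed.

Lemma size_ch v : size (ch v) = q (lev v).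
Proof. exact: card_fset_set (rt_radial T v). Qed.

Lemma chP v u : u \in ch v -> [/\ u != o, par u = v & lev u = (lev v).+1].
Proof.
by rewrite mem_ch => /andP[u0 /eqP pu]; split => //; rewrite (level_par u0) pu.
Qed.

Lemma ch_par u : u != o -> u \in ch (par u).
Proof. by rewrite mem_ch eqxx andbT. Qed.

Notation S := (sector adj o).

Lemma sector_refl v : S v v.
Proof. by exists 0%N. Qed.

Lemma sectorE v y : S v y <-> y = v \/ (y != o /\ S v (par y)).
Proof.
split=> [[k]|[->|[_ [k <-]]]]; [|exact: sector_refl|by exists k.+1; rewrite iterSr].
have [yo|yo] := eqVneq y o.
  by rewrite yo iter_fix ?par_origin// => <-; left.
case: k => [|k]; first by left.
by rewrite iterSr => <-; right; split => //; exists k.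
Qed.

Lemma sector_trans u v y : S u v -> S v y -> S u y.
Proof. by move=> [j uj] [k vk]; exists (j + k)%N; rewrite iterD vk. Qed.

Lemma sector_par u : S (par u) u.
Proof. by exists 1%N. Qed.

Lemma sector_level v y : S v y -> (lev v <= lev y)%N.
Proof.
move=> [k]; elim: k y => [|k IH] y; first by move=> /= ->.
rewrite iterSr => /IH; have [->|y0] := eqVneq y o; first by rewrite par_origin.
by move=> /leq_trans -> //; rewrite (level_par y0).
Qed.

Lemma sector_eq_level u v y : S u y -> S v y -> lev u = lev v -> u = v.
Proof.
move ly : (lev y) => n; elim: n y ly => [|n IH] y ly uy vy luv.
  have /eqP yo : y == o by rewrite -level_eq0 ly.
  case/sectorE: uy => [<-|[]]; last by rewrite yo eqxx.
  by case/sectorE: vy => [<-|[]]; last by rewrite yo eqxx.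
case/sectorE: uy => [eyu|[yo uy]]; case/sectorE: vy => [eyv|[yo' vy]].
- by rewrite -eyu.
- by move: (sector_level vy); rewrite -luv -eyu (level_par yo') ltnn.
- by move: (sector_level uy); rewrite luv -eyv (level_par yo) ltnn.
- by apply: (IH (par y)) => //; move: ly; rewrite (level_par yo) => -[].
Qed.

Lemma sector_origin y : S o y.
Proof.
move ly : (lev y) => n; elim: n y ly => [|n IH] y ly; apply/sectorE.
  by left; apply/eqP; rewrite -level_eq0 ly.
have yo : y != o by rewrite -level_eq0 ly.
by right; split => //; apply: IH; move: ly; rewrite (level_par yo) => -[].
Qed.

Lemma sector_split v y :
  S v y <-> y = v \/ exists2 u, u \in ch v & S u y.
Proof.
split; last first.
  move=> [->|[u /chP[_ <- _] uy]]; first exact: sector_refl.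
  exact: sector_trans (sector_par u) uy.
move=> [k]; elim: k y => [|k IH] y; first by left.
rewrite iterSr; have [->|yo] := eqVneq y o; first by rewrite par_origin; exact: IH.
move=> /IH[py|[u uv upy]]; right.
  by exists y; [rewrite mem_ch yo py eqxx|exact: sector_refl].
by exists u => //; apply/sectorE; right.
Qed.

Lemma sector_ch_notin v u : u \in ch v -> ~ S u v.
Proof. by move=> /chP[_ _ lu] /sector_level; rewrite lu ltnn. Qed.

Lemma sector_ch_inj v u u' y : u \in ch v -> u' \in ch v -> S u y -> S u' y ->
  u = u'.
Proof.
by move=> /chP[_ _ l] /chP[_ _ l'] uy uy'; apply: sector_eq_level uy uy' _; rewrite l l'.
Qed.

Lemma sector_originT : S o = [set: X].
Proof. by apply/seteqP; split => // y _; exact: sector_origin. Qed.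

Lemma ex_ch v : exists u, u \in ch v.
Proof.
have := rt_q_ge2 T (lev v); rewrite -size_ch.
by case: (ch v) => // u s _; exists u; rewrite inE eqxx.
Qed.

(** When [q] is unbounded, [S v] minus [v] can carry an arbitrarily small part of
the mass of [S v]; averages over the two sets are not comparable, which is why
punctured sectors form a family of their own. *)
Definition psector v : set X := [set y | S v y /\ y != v].

Definition ancestors y : set X := [set v | S v y].
Definition pancestors y : set X := [set v | psector v y].

Lemma pancestors_par y : y != o -> pancestors y = ancestors (par y).
Proof.
move=> y0; apply/seteqP; split => v.
  by move=> [/sectorE[->|[]//]]; rewrite eqxx.
move=> vpy; split; first by apply/sectorE; right.
apply/eqP => yv; move: vpy; rewrite /ancestors/= -yv => /sector_level.
by rewrite (level_par y0) ltnn.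
Qed.

Lemma pancestors_origin : pancestors o = set0.
Proof. by apply/seteqP; split => v // -[/sectorE[->|[]]]; rewrite eqxx. Qed.

End Tree.

(** * Sums over sectors *)

Section Sums.
Variables (R : realType) (X : choiceType) (adj : rel X) (o : X) (q : nat -> nat).
Hypothesis T : radial_tree adj o q.

Notation lev := (level adj o).
Notation par := (pred_vertex adj o).
Notation S := (sector adj o).
Notation ch := (ch adj o).
Notation psector := (psector adj o).
Notation ancestors := (ancestors adj o).
Notation pancestors := (pancestors adj o).

Lemma sum_ch_pick (V : nmodType) (G : X -> V) v u : u \in ch v ->
  (forall u', u' \in ch v -> u' != u -> G u' = 0) ->
  \sum_(u' <- ch v) G u' = G u.
Proof.
move=> uv Gu; rewrite (bigD1_seq u) ?uniq_ch//= big_seq_cond big1 ?addr0//.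
by move=> u' /andP[u'v u'u]; exact: Gu.
Qed.

Lemma esum_sector (F : X -> \bar R) v : (forall x, (0 <= F x)%E) ->
  (\esum_(y in S v) F y = F v + \sum_(u <- ch v) \esum_(y in S u) F y)%E.
Proof.
move=> F0.
rewrite -(esum_set1 (F0 v)) esum_mkcond [in RHS]esum_mkcond.
under [X in (_ + X)%E]eq_bigr do rewrite esum_mkcond.
rewrite -esum_sum; last by move=> i j _ _; case: ifP.
rewrite -esumD; last 2 first.
- by move=> i _; case: ifP.
- by move=> i _; apply: sume_ge0 => j _; case: ifP.
apply: eq_esum => y _.
have [yv|yv] := eqVneq y v.
  subst y; rewrite ifT; last exact/mem_set/sector_refl.
  rewrite ifT; last exact/mem_set.
  rewrite big_seq big1 ?adde0// => u uv.
  by rewrite ifF//; apply/memNset/(sector_ch_notin T).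
rewrite [X in (X + _)%E]ifF; last by apply/memNset => /= /eqP; apply/negP.
rewrite add0e; have [vy|vy] := pselect (S v y); last first.
  rewrite ifF; last exact/memNset.
  rewrite big_seq big1// => u uv; rewrite ifF//; apply/memNset => uy.
  by apply: vy; apply/(sector_split T); right; exists u.
rewrite ifT; last exact/mem_set.
case/(sector_split T): vy => [/eqP|[u uv uy]]; first by rewrite (negbTE yv).
rewrite (sum_ch_pick uv); first by rewrite ifT//; exact/mem_set.
move=> u' u'v u'u; rewrite ifF//; apply/memNset => u'y.
by move/negP: u'u; apply; apply/eqP; apply: (sector_ch_inj T u'v uv u'y uy).
Qed.

Lemma sum_ch_const v (a : R) : \sum_(u <- ch v) a = (q (lev v))%:R * a.
Proof. by rewrite big_const_seq count_predT (size_ch T) iter_addr addr0 mulr_natl. Qed.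

Lemma psector_ch v x : (`[< psector v x >])%:R = \sum_(u <- ch v) (`[< S u x >])%:R :> R.
Proof.
case: asboolP => [[vx xv]|nvx].
  move/(sector_split T): vx => [/eqP|[u uv ux]]; first by rewrite (negbTE xv).
  rewrite (sum_ch_pick uv); first by case: asboolP.
  move=> u' u'v u'u; case: asboolP => // u'x.
  by move/eqP: u'u; case; exact: (sector_ch_inj T u'v uv u'x ux).
rewrite big_seq big1// => u uv; case: asboolP => // ux; case: nvx; split.
  by apply/(sector_split T); right; exists u.
by apply/eqP => xv; apply: (sector_ch_notin T uv); rewrite -xv.
Qed.

Lemma esum_psector (F : X -> \bar R) v : (forall x, (0 <= F x)%E) ->
  F v \is a fin_num ->
  (\esum_(y in psector v) F y = \sum_(u <- ch v) \esum_(y in S u) F y)%E.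
Proof.
move=> F0 Fv; have := esum_sector v F0.
rewrite (esumID [set v])//.
have -> : S v `&` [set v] = [set v].
  by apply/seteqP; split => [y []//|y ->]; split => //; exact: sector_refl.
have -> : S v `&` ~` [set v] = psector v.
  by apply/seteqP; split => y [vy /eqP yv].
rewrite esum_set1// addeC => e.
by rewrite -[LHS](addeK _ Fv) e addeAC subee// add0e.
Qed.

Lemma esum_ancestors (a : X -> \bar R) y : (forall v, (0 <= a v)%E) ->
  (\esum_(v in ancestors y) a v = a y + \esum_(v in pancestors y) a v)%E.
Proof.
move=> a0; rewrite (esumID [set y])//.
have -> : ancestors y `&` [set y] = [set y].
  by apply/seteqP; split => [v []//|v ->]; split => //; exact: sector_refl.
rewrite esum_set1//; congr (_ + esum _ _)%E; apply/seteqP; split => v [].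
  by move=> vy /eqP; rewrite eq_sym.
by move=> vy yv; split => //; apply/eqP; rewrite eq_sym.
Qed.

(** The sum over the first [n] levels of the sector of [v]; the recursion over the
children matches [esum_sector] and makes induction on [n] available. *)
Fixpoint psum (n : nat) (F : X -> R) (v : X) : R :=
  if n is n'.+1 then F v + \sum_(u <- ch v) psum n' F u else 0.

Lemma psumB n (F G : X -> R) v :
  psum n (fun x => F x - G x) v = psum n F v - psum n G v.
Proof.
elim: n v => [|n IH] v /=; first by rewrite subr0.
under eq_bigr do rewrite IH.
by rewrite sumrB; ring.
Qed.

Lemma eq_psum n (F G : X -> R) v : (forall y, S v y -> F y = G y) ->
  psum n F v = psum n G v.
Proof.
elim: n v => [|n IH] v FG //=; congr (_ + _); first exact/FG/sector_refl.
rewrite big_seq [RHS]big_seq; apply: eq_bigr => u uv; apply: IH => y uy.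
by apply: FG; apply/(sector_split T); right; exists u.
Qed.

Lemma psum_esum n (F : X -> R) v : (forall x, 0 <= F x) ->
  (psum n F v)%:E =
  (\esum_(y in S v) (if (lev y < lev v + n)%N then F y else 0)%:E)%E.
Proof.
move=> F0; elim: n v => [|n IH] v.
  rewrite esum1// => y /(sector_level T).
  by rewrite addn0 leqNgt => /negbTE ->.
rewrite esum_sector; last by move=> x; case: ifP; rewrite lee_fin.
rewrite addnS ltnS leq_addr /= EFinD; congr (_ + _)%E.
rewrite -sumEFin big_seq [RHS]big_seq; apply: eq_bigr => u /(chP T)[_ _ lu].
by rewrite IH lu addSn.
Qed.

Lemma psum_le_esum n (F : X -> R) v : (forall x, 0 <= F x) ->
  ((psum n F v)%:E <= \esum_(y in S v) (F y)%:E)%E.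
Proof.
move=> F0; rewrite psum_esum//; apply: le_esum => y _.
by case: ifP; rewrite lee_fin.
Qed.

Lemma psum_nondecreasing (F : X -> R) v : (forall x, 0 <= F x) ->
  {homo (fun n => psum n F v) : m n / (m <= n)%N >-> m <= n}.
Proof.
move=> F0 m n mn; rewrite -lee_fin !psum_esum//; apply: le_esum => y _.
rewrite lee_fin; case: ifP => [lt1|]; last by case: ifP.
by rewrite (leq_trans lt1)// leq_add2l.
Qed.

(** A finite set of vertices meets only finitely many levels, so the sums over the
first levels are cofinal among all finite sums. *)
Lemma esum_sector_le (F : X -> R) v (b : \bar R) : (forall x, 0 <= F x) ->
  (forall n, ((psum n F v)%:E <= b)%E) ->
  (\esum_(y in S v) (F y)%:E <= b)%E.
Proof.
move=> F0 Fb; apply: ge_ereal_sup => _ [A [finA AS] <-].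
pose N := (\max_(y <- fset_set A) lev y).+1.
apply: le_trans (Fb N); rewrite psum_esum//.
apply: esum_ge; exists A; first by split.
rewrite !fsbig_finite//= big_seq [leRHS]big_seq; apply: lee_sum => y yA.
rewrite ifT// /N addnS ltnS; apply: leq_trans (leq_addl _ _).
exact: leq_bigmax_seq.
Qed.

Lemma psum_cvg (F : X -> R) v l : (forall x, 0 <= F x) ->
  (\esum_(y in S v) (F y)%:E = l%:E)%E ->
  (fun n => psum n F v) @ \oo --> l.
Proof.
move=> F0 Fl.
have hub : has_ubound (range (fun n => psum n F v)).
  by exists l => _ [n _ <-]; rewrite -lee_fin -Fl; exact: psum_le_esum.
have := nondecreasing_cvgn (psum_nondecreasing v F0) hub.
suff -> : sup (range (fun n => psum n F v)) = l by [].
apply/eqP; rewrite eq_le; apply/andP; split.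
  apply: ge_sup; first by exists (psum 0 F v), 0%N.
  by move=> _ [n _ <-]; rewrite -lee_fin -Fl; exact: psum_le_esum.
rewrite -lee_fin -Fl; apply: esum_sector_le => // n.
by rewrite lee_fin; apply: ub_le_sup => //; exists n.
Qed.

(** Only absolutely summable families are concerned, so the sum can be taken level
by level; the pairings with harmonic functions are computed in this way. *)
Lemma ssum_psum (F : X -> R) v : (\esum_(y in S v) `|F y|%:E < +oo)%E ->
  exists2 l, ssum (S v) F = l%:E & (fun n => psum n F v) @ \oo --> l.
Proof.
move=> Ffin.
pose Fp x := Num.max (F x) 0; pose Fm x := Num.max (- F x) 0.
have Fp0 x : 0 <= Fp x by rewrite /Fp le_max lexx orbT.
have Fm0 x : 0 <= Fm x by rewrite /Fm le_max lexx orbT.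
have fin G : (forall x, 0 <= G x <= `|F x|) ->
    exists l, (\esum_(y in S v) (G y)%:E = l%:E)%E.
  move=> HG; have : (\esum_(y in S v) (G y)%:E)%E \is a fin_num.
    rewrite ge0_fin_numE; last first.
      by apply: esum_ge0 => x _; rewrite lee_fin; case/andP: (HG x).
    apply: le_lt_trans Ffin; apply: le_esum => x _.
    by rewrite lee_fin; case/andP: (HG x).
  by move=> /fineK <-; eexists.
have [lp hlp] : exists l, (\esum_(y in S v) (Fp y)%:E = l%:E)%E.
  apply: fin => x; rewrite Fp0 /Fp ge_max normr_ge0 andbT; exact: ler_norm.
have [lm hlm] : exists l, (\esum_(y in S v) (Fm y)%:E = l%:E)%E.
  apply: fin => x; rewrite Fm0 /Fm ge_max normr_ge0 andbT -normrN; exact: ler_norm.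
exists (lp - lm).
  rewrite /ssum; under eq_esum do rewrite funepos_EFin.
  by rewrite hlp; under eq_esum do rewrite funeneg_EFin; rewrite hlm.
have -> : (fun n => psum n F v) = (fun n => psum n Fp v - psum n Fm v).
  apply/funext => n; rewrite -psumB; apply: eq_psum => y _.
  by rewrite /Fp /Fm; case: leP => ?; case: leP => ?; lra.
by apply: cvgB; exact: psum_cvg.
Qed.

End Sums.

(** * Families of sets with geometric decay *)

Section Schur.
Variable R : realType.
Local Open Scope ereal_scope.

Variables (X I : choiceType) (Q : I -> set X) (j : I -> X -> nat).
Variables (p lam A B : R) (G : R -> R) (m TW TS : I -> R) (w mu f : X -> R).
Hypothesis p1 : (1 < p)%R.
Hypothesis lam1 : (1 < lam)%R.
Hypothesis A0 : (0 < A)%R.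
Hypothesis B0 : (0 < B)%R.
Hypothesis m0 : forall i, (0 < m i)%R.
Hypothesis TW0 : forall i, (0 < TW i)%R.
Hypothesis TS0 : forall i, (0 < TS i)%R.
Hypothesis w0 : forall x, (0 < w x)%R.
Hypothesis mu0 : forall x, (0 < mu x)%R.
Hypothesis sumW : forall i,
  \esum_(x in Q i) (w x * mu x * lam ^+ j i x)%:E <= (A * TW i)%:E.
Hypothesis sumS : forall i,
  \esum_(x in Q i) (w x `^ (- (p - 1)^-1) * mu x * lam ^+ j i x)%:E <=
  (A * TS i)%:E.
Hypothesis Ap : forall i, (TW i * TS i `^ (p - 1) <= B * m i `^ p)%R.
Hypothesis G0 : forall r : R, (0 < r < 1)%R -> (0 < G r)%R.
Hypothesis sumj : forall (r : R) x, (0 < r < 1)%R ->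
  \esum_(i in [set i | Q i x]) (r ^+ j i x)%:E <= (G r)%:E.

Let p0 : (0 < p)%R. Proof. by move: p1; lra. Qed.
Let pm0 : (0 < p - 1)%R. Proof. by move: p1; lra. Qed.
Let lam0 : (0 < lam)%R. Proof. by move: lam1; lra. Qed.

Let r1 : R := (lam `^ (- (p - 1)))%R.
Let r2 : R := (lam `^ (- (p - 1)^-1))%R.

Let powR_lam_lt1 (t : R) : (0 < t)%R -> (0 < lam `^ (- t) < 1)%R.
Proof. exact: powRN_lt1. Qed.

Let F (i : I) : \bar R := \esum_(y in Q i) (`|f y| * mu y)%:E.
Let N : \bar R := \esum_(x in [set: X]) (`|f x| `^ p * w x * mu x)%:E.

Let powF i : poweR (F i) p <= ((A * TS i) `^ (p - 1))%:E *
  \esum_(y in Q i) (`|f y| `^ p * w y * mu y * r1 ^+ j i y)%:E.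
Proof.
(* Conjugate exponents are split between the factors so that the [p']-th power of
[b] is the dual weight times [lam ^+ j]. *)
pose t := (lam `^ ((p - 1) / p))%R.
have t0 : (0 < t)%R by rewrite powR_gt0.
pose a y := (`|f y| * w y `^ p^-1 * mu y `^ p^-1 * t^-1 ^+ j i y)%R.
pose b y := (w y `^ (- p^-1) * mu y `^ ((p - 1) / p) * t ^+ j i y)%R.
have e1 y : (`|f y| * mu y = a y * b y)%R.
  have -> : (a y * b y = `|f y| * (w y `^ p^-1 * w y `^ (- p^-1)) *
    (mu y `^ p^-1 * mu y `^ ((p - 1) / p)) * (t^-1 * t) ^+ j i y)%R.
    by rewrite exprMn_comm//; rewrite /a /b; ring.
  rewrite mulVf ?lt0r_neq0// expr1n mulr1 -!powRD; last 2 first.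
  - by rewrite (negbTE (lt0r_neq0 (mu0 y))) implybT.
  - by rewrite (negbTE (lt0r_neq0 (w0 y))) implybT.
  rewrite subrr powRr0 mulr1.
  have -> : (p^-1 + (p - 1) / p = 1)%R by field; exact: lt0r_neq0.
  by rewrite powRr1// ltW.
have e2 y : (a y `^ p = `|f y| `^ p * w y * mu y * r1 ^+ j i y)%R.
  rewrite /a !powRM ?mulr_ge0 ?powR_ge0 ?exprn_ge0 ?invr_ge0 ?(ltW t0)//.
  rewrite powR_expn ?invr_ge0 ?(ltW t0)// -!powRrM mulVf ?lt0r_neq0//.
  rewrite !powRr1 ?(ltW (w0 y)) ?(ltW (mu0 y))//.
  congr (_ * _ ^+ _)%R; rewrite /t -powR_inv1 ?powR_ge0// -!powRrM /r1.
  by congr (_ `^ _)%R; field; exact: lt0r_neq0.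
have e3 y : (b y `^ (p / (p - 1)) = w y `^ (- (p - 1)^-1) * mu y * lam ^+ j i y)%R.
  rewrite /b !powRM ?mulr_ge0 ?powR_ge0 ?exprn_ge0 ?(ltW t0)//.
  rewrite powR_expn ?(ltW t0)// /t -!powRrM.
  have -> : (- p^-1 * (p / (p - 1)) = - (p - 1)^-1)%R by field; rewrite !lt0r_neq0.
  have -> : ((p - 1) / p * (p / (p - 1)) = 1)%R by field; rewrite !lt0r_neq0.
  by rewrite !powRr1 ?ltW.
rewrite /F; under eq_esum do rewrite e1.
under [X in _ <= _ * X]eq_esum do rewrite -e2.
apply: esum_holder => //.
- by move=> y; rewrite /a !mulr_ge0 ?powR_ge0 ?exprn_ge0 ?invr_ge0 ?(ltW t0).
- by move=> y; rewrite /b !mulr_ge0 ?powR_ge0 ?exprn_ge0 ?(ltW t0).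
- by rewrite mulr_gt0.
- by under eq_esum do rewrite e3; exact: sumS.
Qed.

Let sum_powF : \esum_(i in [set: I]) ((TW i / m i `^ p)%:E * poweR (F i) p) <=
  (A `^ (p - 1) * B * G r1)%:E * N.
Proof.
have step i : (TW i / m i `^ p)%:E * poweR (F i) p <= (A `^ (p - 1) * B)%:E *
    \esum_(y in [set y | Q i y]) (`|f y| `^ p * w y * mu y * r1 ^+ j i y)%:E.
  have mp : (0 < m i `^ p)%R by rewrite powR_gt0.
  apply: (@le_trans _ _ ((TW i / m i `^ p)%:E * (((A * TS i) `^ (p - 1))%:E *
     \esum_(y in [set y | Q i y]) (`|f y| `^ p * w y * mu y * r1 ^+ j i y)%:E))).
    by rewrite lee_wpmul2l// lee_fin divr_ge0// ltW.
  rewrite muleA -EFinM lee_wpmul2r//.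
    apply: esum_ge0 => y _; rewrite lee_fin !mulr_ge0// ?powR_ge0 ?exprn_ge0 ?powR_ge0//; exact: ltW.
  rewrite lee_fin powRM ?(ltW A0) ?(ltW (TS0 i))// mulrCA ler_wpM2l ?powR_ge0//.
  by rewrite mulrAC ler_pdivrMr.
apply: (le_trans (le_esum (fun i _ => step i))).
rewrite ge0_esumZl; last 2 first.
- by rewrite mulr_ge0 ?powR_ge0// ltW.
- by move=> i _; apply: esum_ge0 => y _; rewrite lee_fin !mulr_ge0// ?powR_ge0 ?exprn_ge0 ?powR_ge0//; exact: ltW.
rewrite (esum_exchange (fun i y => Q i y)); last first.
  by move=> i y; rewrite lee_fin !mulr_ge0// ?powR_ge0 ?exprn_ge0 ?powR_ge0//; exact: ltW.
rewrite [in leRHS]EFinM -[leRHS]muleA lee_wpmul2l//.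
  by rewrite lee_fin mulr_ge0 ?powR_ge0// ltW.
have r101 := powR_lam_lt1 pm0.
rewrite /N -ge0_esumZl; last 2 first.
- exact/ltW/G0.
- by move=> x _; rewrite lee_fin !mulr_ge0// ?powR_ge0//; exact: ltW.
apply: le_esum => x _.
under eq_esum do rewrite EFinM.
rewrite ge0_esumZl; last 2 first.
- by rewrite !mulr_ge0// ?powR_ge0//; exact: ltW.
- by move=> i _; rewrite lee_fin exprn_ge0 ?powR_ge0.
rewrite muleC lee_wpmul2r//; last exact: sumj.
by rewrite lee_fin !mulr_ge0// ?powR_ge0//; exact: ltW.
Qed.

Let powsum x : (forall i, F i < +oo) ->
  poweR (\esum_(i in [set i | Q i x]) ((m i)^-1%:E * F i)) p <=
  (G r2 `^ (p - 1))%:E *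
  \esum_(i in [set i | Q i x]) ((m i `^ p)^-1%:E * poweR (F i) p * (lam ^+ j i x)%:E).
Proof.
move=> Ffin.
have F0 i : 0 <= F i.
  by apply: esum_ge0 => y _; rewrite lee_fin mulr_ge0// ltW.
have [g gE] : exists g : I -> R, forall i, F i = (g i)%:E.
  by exists (fun i => fine (F i)) => i; rewrite fineK// ge0_fin_numE.
have g0 i : (0 <= g i)%R by rewrite -lee_fin -gE.
pose t := (lam `^ (p^-1))%R.
have t0 : (0 < t)%R by rewrite powR_gt0.
pose a i := ((m i)^-1 * g i * t ^+ j i x)%R.
pose b i := (t^-1 ^+ j i x)%R.
under eq_esum => i _.
  rewrite gE -EFinM (_ : (_ * _ = a i * b i)%R); last first.
    by rewrite /a /b -mulrA -exprMn_comm ?mulfV ?expr1n ?mulr1 ?lt0r_neq0//; exact: mulrC.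
  over.
under [X in _ <= _ * X]eq_esum => i _.
  rewrite gE poweR_EFin -!EFinM (_ : (_ * _ = a i `^ p)%R); last first.
    rewrite /a !powRM ?mulr_ge0 ?invr_ge0 ?exprn_ge0 ?(ltW t0) ?(ltW (m0 i))//.
    rewrite powR_expn ?(ltW t0)// -powRrM mulVf ?lt0r_neq0// powRr1 ?ltW//.
    by rewrite -(powR_inv1 (ltW (m0 i))) powRAC powR_inv1 ?powR_ge0.
  over.
have r201 : (0 < r2 < 1)%R by apply: powR_lam_lt1; rewrite invr_gt0.
apply: esum_holder => //.
- by move=> i; rewrite /a !mulr_ge0 ?invr_ge0 ?exprn_ge0 ?(ltW t0) ?(ltW (m0 i)).
- by move=> i; rewrite /b exprn_ge0 ?invr_ge0 ?(ltW t0).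
- exact: G0.
apply: le_trans (sumj x r201); apply: le_esum => i _; rewrite lee_fin.
rewrite /b powR_expn ?invr_ge0 ?(ltW t0)//.
suff -> : (t^-1 `^ (p / (p - 1)) = r2)%R by [].
rewrite -(powR_inv1 (ltW t0)) /t -!powRrM /r2; congr (_ `^ _)%R.
by field; rewrite !lt0r_neq0.
Qed.

(** Hölder's inequality is applied twice with powers of [lam ^+ j] thrown in: to
the sum over the sets containing [x], and to the average over each set.  The
points deep inside [Q i] carry exponentially little weight, so a growing factor
is affordable on them, while its inverse makes the sum over all sets containing
a given point converge. *)
Lemma geometric_family_bound :
  \esum_(x in [set: X]) ((w x * mu x)%:E *
    poweR (\esum_(i in [set i | Q i x])
      ((m i)^-1%:E * \esum_(y in Q i) (`|f y| * mu y)%:E)) p) <=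
  (G r2 `^ (p - 1) * A * (A `^ (p - 1) * B * G r1))%:E *
  \esum_(x in [set: X]) (`|f x| `^ p * w x * mu x)%:E.
Proof.
have r101 := powR_lam_lt1 pm0.
have r201 : (0 < r2 < 1)%R by apply: powR_lam_lt1; rewrite invr_gt0.
have G1 := G0 r101; have G2 := G0 r201.
have C1 : (0 < A `^ (p - 1) * B * G r1)%R by rewrite !mulr_gt0 ?powR_gt0.
have C2 : (0 < G r2 `^ (p - 1) * A)%R by rewrite mulr_gt0 ?powR_gt0.
have h0 x : (0 <= `|f x| `^ p * w x * mu x)%R.
  by rewrite !mulr_ge0// ?powR_ge0//; exact: ltW.
rewrite -/N.
have N0 : 0 <= N by apply: esum_ge0 => x _; rewrite lee_fin.
case: (leP +oo N) => [|Nfin].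
  by rewrite leye_eq => /eqP ->; rewrite gt0_muley ?leey// lte_fin mulr_gt0.
have F0 i : 0 <= F i.
  by apply: esum_ge0 => y _; rewrite lee_fin mulr_ge0// ltW.
have Ffin i : F i < +oo.
  apply: (@lty_poweRy _ _ p); first exact: lt0r_neq0.
  apply: le_lt_trans (powF i) _.
  apply: (@le_lt_trans _ _ (((A * TS i) `^ (p - 1))%:E * N)); last first.
    by rewrite lte_mul_pinfty ?lee_fin ?powR_ge0.
  rewrite lee_wpmul2l ?lee_fin ?powR_ge0// /N esum_mkcond; apply: le_esum => x _.
  case: ifP => _; rewrite lee_fin// ler_piMr//.
  by rewrite exprn_ile1 ?powR_ge0//; case/andP: r101 => _ /ltW.
have q0 i x : 0 <= (m i `^ p)^-1%:E * poweR (F i) p * (lam ^+ j i x)%:E.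
  by rewrite !mule_ge0 ?poweR_ge0 ?lee_fin ?invr_ge0 ?powR_ge0 ?exprn_ge0// ltW.
apply: (@le_trans _ _ (\esum_(x in [set: X]) ((G r2 `^ (p - 1))%:E *
   \esum_(i in [set i | Q i x]) ((w x * mu x)%:E *
     ((m i `^ p)^-1%:E * poweR (F i) p * (lam ^+ j i x)%:E))))).
  apply: le_esum => x _.
  rewrite ge0_esumZl//; last by rewrite mulr_ge0// ltW.
  rewrite muleCA lee_wpmul2l ?lee_fin ?mulr_ge0 ?(ltW (w0 x)) ?(ltW (mu0 x))//.
  exact: powsum.
have wm0 x : (0 <= w x * mu x)%R by rewrite mulr_ge0// ltW.
rewrite ge0_esumZl ?powR_ge0//; last first.
  by move=> x _; apply: esum_ge0 => i _; rewrite mule_ge0 ?lee_fin.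
rewrite (esum_exchange (fun x i => Q i x)); last first.
  by move=> x i; rewrite mule_ge0 ?lee_fin.
rewrite -mulrA EFinM -muleA lee_wpmul2l ?lee_fin ?powR_ge0//.
rewrite EFinM -muleA; apply: le_trans (lee_wpmul2l _ sum_powF); last first.
  by rewrite lee_fin ltW.
rewrite -ge0_esumZl ?(ltW A0)//; last first.
  by move=> i _; rewrite mule_ge0 ?poweR_ge0// lee_fin divr_ge0 ?powR_ge0// ltW.
apply: le_esum => i _.
have gE : F i = (fine (F i))%:E by rewrite fineK// ge0_fin_numE.
have g0 : (0 <= fine (F i))%R by rewrite fine_ge0.
rewrite gE poweR_EFin; set g := (fine (F i) `^ p)%R.
have gp0 : (0 <= (m i `^ p)^-1 * g)%R by rewrite mulr_ge0 ?invr_ge0 ?powR_ge0.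
apply: (@le_trans _ _ (((m i `^ p)^-1 * g)%:E *
    \esum_(x in Q i) (w x * mu x * lam ^+ j i x)%:E)).
  rewrite -ge0_esumZl//; last first.
    by move=> x _; rewrite lee_fin mulr_ge0 ?exprn_ge0 ?(ltW lam0)//.
  by apply: le_esum => x _; rewrite -!EFinM lee_fin mulrCA.
apply: le_trans (lee_wpmul2l _ (sumW i)) _; first by rewrite lee_fin.
rewrite -!EFinM lee_fin le_eqVlt; apply/orP; left; apply/eqP.
by ring.
Qed.

End Schur.

(** * Harmonic functions and the Bergman kernel *)

Section Kernel.
Variables (R : realType) (X : choiceType) (adj : rel X) (o : X) (q : nat -> nat).
Hypothesis T : radial_tree adj o q.
Variables (alpha c : R).
Hypothesis alpha1 : 1 < alpha.
Hypothesis c0 : 0 < c.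

Notation lev := (level adj o).
Notation par := (pred_vertex adj o).
Notation S := (sector adj o).
Notation ch := (ch adj o).
Notation psector := (psector adj o).
Notation ancestors := (ancestors adj o).
Notation pancestors := (pancestors adj o).
Notation mu := (mass adj o q alpha c).
Notation psum := (psum adj o).

Definition level_mass (k : nat) : R := c * \prod_(l < k) (q l)%:R `^ (- alpha).

Lemma q_gt0 k : 0 < (q k)%:R :> R.
Proof. by rewrite ltr0n; apply: leq_trans (rt_q_ge2 T k). Qed.

Lemma q_ge2 k : 2 <= (q k)%:R :> R.
Proof. by rewrite (ler_nat R 2); apply: rt_q_ge2 T k. Qed.

Lemma mass_level x : mu x = level_mass (lev x).
Proof. by []. Qed.

Lemma level_mass_gt0 k : 0 < level_mass k.
Proof.
rewrite /level_mass mulr_gt0//; elim/big_rec: _ => // i x _ x0.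
by rewrite mulr_gt0// powR_gt0 ?q_gt0.
Qed.

Lemma mass_gt0 x : 0 < mu x.
Proof. by rewrite mass_level level_mass_gt0. Qed.

Lemma level_massS k : level_mass k.+1 = level_mass k * (q k)%:R `^ (- alpha).
Proof. by rewrite /level_mass big_ord_recr/= mulrA. Qed.

Definition mass_ratio : R := (1 - 2 `^ (1 - alpha))^-1.

Lemma mass_ratio_base : 0 < 1 - (2 : R) `^ (1 - alpha).
Proof.
rewrite subr_gt0 -opprB.
by have /andP[] : 0 < (2 : R) `^ (- (alpha - 1)) < 1
  by apply: powRN_lt1; rewrite ?ltr1n ?subr_gt0.
Qed.

Lemma mass_ratio_gt0 : 0 < mass_ratio.
Proof. by rewrite invr_gt0 mass_ratio_base. Qed.

Definition child_mass v : R := (q (lev v))%:R * level_mass (lev v).+1.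

Lemma child_mass_gt0 v : 0 < child_mass v.
Proof. by rewrite mulr_gt0 ?q_gt0 ?level_mass_gt0. Qed.

Lemma sum_ch_mass v : \sum_(u <- ch v) mu u = child_mass v.
Proof.
rewrite /child_mass -(sum_ch_const T) big_seq [RHS]big_seq.
by apply: eq_bigr => u /(chP T)[_ _ lu]; rewrite mass_level lu.
Qed.

Lemma child_mass_le v : child_mass v <= 2 `^ (1 - alpha) * mu v.
Proof.
rewrite /child_mass level_massS mulrCA mulrC ler_wpM2r ?(ltW (level_mass_gt0 _))//.
rewrite -[X in X * _]powRr1 ?ler0n// -powRD; last first.
  by rewrite (negbTE (lt0r_neq0 (q_gt0 _))) implybT.
have -> : 1 - alpha = - (alpha - 1) by ring.
rewrite !powRN lef_pV2 ?posrE ?powR_gt0 ?q_gt0//.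
apply: ge0_ler_powR; rewrite ?nnegrE ?ler0n ?q_ge2//.
by rewrite subr_ge0 ltW.
Qed.

(** The masses of successive levels of a sector decrease at least as fast as the
powers of [2 `^ (1 - alpha)], by [child_mass_le]. *)
Lemma sector_mass_le v :
  (\esum_(y in S v) (mu y)%:E <= (mass_ratio * mu v)%:E)%E.
Proof.
apply: (esum_sector_le T) => [x|n]; first exact/ltW/mass_gt0.
rewrite lee_fin; elim: n v => [|n IH] v /=.
  by rewrite mulr_ge0// ltW ?mass_gt0 ?mass_ratio_gt0.
apply: (@le_trans _ _ (mu v + mass_ratio * child_mass v)).
  by rewrite lerD2l -sum_ch_mass mulr_sumr; apply: ler_sum => u _.
have e : mass_ratio * mu v = mu v + mass_ratio * (2 `^ (1 - alpha) * mu v).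
  rewrite /mass_ratio; field; exact: lt0r_neq0 mass_ratio_base.
by rewrite [leRHS]e lerD2l ler_wpM2l ?child_mass_le// ltW ?mass_ratio_gt0.
Qed.

Definition neighbours x := if x == o then ch x else par x :: ch x.

Lemma uniq_neighbours x : uniq (neighbours x).
Proof.
rewrite /neighbours; case: eqVneq => x0; first exact: uniq_ch.
rewrite /= uniq_ch andbT; apply/negP => /(chP T)[_ _ l].
by move: (level_par T x0); rewrite l => /eqP; rewrite -addn2 -[X in X == _]addn0 eqn_add2l.
Qed.

Lemma neighboursP x : [set y | gdist adj x y = 1%N] = [set` neighbours x].
Proof.
apply/seteqP; split => y /=.
  move=> /(gdist_eq1 T)/(adjP T)[/(childrenP T)[y0 py]|[x0 px]].
    have : y \in ch x by rewrite (mem_ch T) y0 py eqxx.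
    by rewrite /neighbours; case: ifP => // _; rewrite inE orbC => ->.
  by rewrite /neighbours (negbTE x0) px inE eqxx.
move=> yx; apply/(gdist_eq1 T)/(adjP T).
have chy : y \in ch x -> children adj o x y.
  by rewrite (mem_ch T) => /andP[y0 /eqP py]; apply/(childrenP T).
move: yx; rewrite /neighbours; case: eqVneq => x0; first by left; exact: chy.
by rewrite inE => /orP[/eqP ->|]; [right|left; exact: chy].
Qed.

Definition balance (f : X -> R) (x : X) : R :=
  \sum_(u <- ch x) (f u - f x) + (if x == o then 0 else f (par x) - f x).

Lemma harmonic_balance f : harmonic_fun adj f <-> forall x, balance f x = 0.
Proof.
suff lap x : (laplacian adj f x = 0) <-> (balance f x = 0).
  by split=> H x; apply/lap/H.
rewrite /laplacian neighboursP.
have cardE : (#|` fset_set [set` neighbours x]|)%:R = \sum_(y <- neighbours x) (1 : R).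
  rewrite (fsbig_seq _ (fun=> 1 : R) (uniq_neighbours x)) fsbig_finite//=.
  by rewrite big_const_seq count_predT iter_addr addr0.
rewrite cardE -fsbig_seq ?uniq_neighbours//.
have -> : balance f x = \sum_(y <- neighbours x) (f y - f x).
  rewrite /balance /neighbours; case: eqVneq => x0; first by rewrite addr0.
  by rewrite big_cons addrC.
have n0 : \sum_(y <- neighbours x) (1 : R) != 0.
  rewrite big_const_seq count_predT iter_addr addr0 pnatr_eq0 -lt0n.
  rewrite /neighbours; case: ifP => //= _; rewrite (size_ch T).
  by apply: leq_trans (rt_q_ge2 T _).
rewrite sumrB (_ : \sum_(i <- neighbours x) f x = f x * \sum_(y <- neighbours x) 1); last first.
  by rewrite mulr_sumr; under [RHS]eq_bigr do rewrite mulr1.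
set N := \sum_(y <- neighbours x) 1 in n0 *; set F := \sum_(y <- _) f y.
split=> H.
  have -> : F = N * (N^-1 * F) by rewrite mulrA mulfV// mul1r.
  by rewrite -(subr0_eq H) mulrC subrr.
by rewrite (subr0_eq H) mulrC mulfK// subrr.
Qed.

(** The profile of harmonic functions on a sector that depend on the level alone
and vanish at the parent of its vertex: [k] is the level of that parent and [j]
the distance to it.  The recursion runs downwards in the tree by moving the base
point, which makes the bounds immediate; harmonicity is [phi_rec]. *)
Fixpoint phi (k j : nat) : R :=
  if j is j'.+1 then 1 + phi k.+1 j' / (q k.+1)%:R else 0.

Lemma phi_bounds k j : 0 <= phi k j <= 2.
Proof.
elim: j k => [|j IH] k /=; first by rewrite lexx ler0n.
have /andP[h0 h2] := IH k.+1; rewrite addr_ge0 ?divr_ge0//=.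
rewrite -[leRHS]/(1 + 1) lerD2l ler_pdivrMr ?q_gt0// mul1r.
exact: le_trans (q_ge2 _).
Qed.

Lemma phiS k j : phi k j.+1 = 1 + phi k.+1 j / (q k.+1)%:R.
Proof. by []. Qed.

Lemma phi_rec k j :
  (q (k + j.+1))%:R * (phi k j.+2 - phi k j.+1) = phi k j.+1 - phi k j.
Proof.
elim: j k => [|j IH] k.
  by rewrite /= addn1 mul0r; field; exact: lt0r_neq0 (q_gt0 _).
have -> : phi k j.+3 - phi k j.+2 = (phi k.+1 j.+2 - phi k.+1 j.+1) / (q k.+1)%:R.
  by rewrite (phiS k j.+2) (phiS k j.+1); ring.
by rewrite -addSnnS mulrA IH (phiS k j.+1) (phiS k j); ring.
Qed.

Definition bump_fun (u y : X) : R :=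
  if `[< S u y >] then phi (lev u).-1 (lev y - (lev u).-1) else 0.

Lemma bump_bounds u y : 0 <= bump_fun u y <= 2 * (`[< S u y >])%:R.
Proof.
rewrite /bump_fun; case: ifP => _; last by rewrite mulr0 lexx.
by rewrite mulr1 phi_bounds.
Qed.

Lemma bump_in u y : S u y ->
  bump_fun u y = phi (lev u).-1 (lev y - (lev u).-1).
Proof. by move=> uy; rewrite /bump_fun ifT//; apply/asboolP. Qed.

Lemma bump_out u y : ~ S u y -> bump_fun u y = 0.
Proof. by move=> uy; rewrite /bump_fun ifF//; apply/asboolPn. Qed.

(** [bump_fun u] is harmonic off the parent of [u], so that its difference with
the function of a sibling is harmonic everywhere. *)
Lemma balance_bump u y : u != o -> balance (bump_fun u) y = (y == par u)%:R.
Proof.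
move=> u0; have lu := level_par T u0.
have [ey|yp] := eqVneq y (par u).
  have uch : u \in ch y by rewrite ey (ch_par T).
  have -> : balance (bump_fun u) y = \sum_(v <- ch y) (bump_fun u v - 0) + 0.
    have by0 : bump_fun u y = 0 by apply: bump_out; exact: (sector_ch_notin T uch).
    rewrite /balance by0; congr (_ + _); case: eqVneq => // y0.
    rewrite bump_out ?subrr// => /(sector_level T).
    by rewrite lu -ey (level_par T y0) ltnNge leqnSn.
  rewrite addr0 (sum_ch_pick uch); last first.
    move=> v vy vu; rewrite subr0 bump_out// => uv.
    move/eqP: vu; apply; apply: (sector_ch_inj T vy uch _ uv); exact: sector_refl.
  rewrite subr0 bump_in; last exact: sector_refl.
  by rewrite lu/= subSnn /= mul0r addr0.
have [uy|uy] := pselect (S u y); last first.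
  rewrite /balance bump_out// big_seq big1; last first.
    move=> v vy; rewrite bump_out ?subrr// => /(sectorE T)[vu|[_]].
      by move/eqP: yp; apply; have [_ <- _] := chP T vy; rewrite vu.
    by have [_ -> _] := chP T vy.
  rewrite add0r; case: ifP => // /negbT y0.
  rewrite bump_out ?subrr// => upy; apply: uy; apply/(sectorE T); by right.
have y0 : y != o.
  by apply: contraNneq u0 => ey; move/(sectorE T): uy; rewrite ey => -[->|[]]; rewrite ?eqxx.
rewrite /balance (negbTE y0); set k := (lev u).-1.
have luk : lev u = k.+1 by rewrite /k lu.
have [j ly] : exists j, lev y = (k + j.+1)%N.
  exists (lev y - lev u)%N; rewrite addnS -addSn -luk subnKC//.
  exact: (sector_level T uy).
have -> : \sum_(v <- ch y) (bump_fun u v - bump_fun u y) =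
    \sum_(v <- ch y) (phi k j.+2 - phi k j.+1).
  rewrite big_seq [RHS]big_seq; apply: eq_bigr => v vy; have [v0 pv lv] := chP T vy.
  rewrite !bump_in//; last by apply/(sectorE T); right; rewrite pv.
  by rewrite -/k lv ly -addnS !addKn.
rewrite (sum_ch_const T) ly phi_rec.
have -> : bump_fun u y = phi k j.+1 by rewrite bump_in// -/k ly addKn.
suff -> : bump_fun u (par y) = phi k j by rewrite [RHS]/=; ring.
have lpy : lev (par y) = (k + j)%N.
  by move: ly; rewrite (level_par T y0) addnS => -[].
case/(sectorE T): uy => [eyu|[_ upy]]; last by rewrite bump_in// -/k lpy addKn.
rewrite bump_out.
  by move: ly; rewrite eyu luk -addn1 => /addnI [<-].
by rewrite eyu => /(sector_level T); rewrite [X in (X <= _)%N]lu ltnn.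
Qed.

Lemma harmonic_bump_sub u u' : u != o -> u' != o -> par u = par u' ->
  harmonic_fun adj (fun y => bump_fun u y - bump_fun u' y).
Proof.
move=> u0 u'0 puu'; apply/harmonic_balance => x.
have -> : balance (fun y => bump_fun u y - bump_fun u' y) x =
    balance (bump_fun u) x - balance (bump_fun u') x.
  rewrite /balance; have -> : \sum_(v <- ch x) (bump_fun u v - bump_fun u' v -
      (bump_fun u x - bump_fun u' x)) = \sum_(v <- ch x) (bump_fun u v - bump_fun u x) -
      \sum_(v <- ch x) (bump_fun u' v - bump_fun u' x).
    by rewrite -sumrB; apply: eq_bigr => v _; ring.
  by case: ifP => _; ring.
by rewrite !balance_bump// puu' subrr.
Qed.

(** The coefficients in [psum_harmonic] of the value at the parent and of the
increment from the parent. *)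
Fixpoint mean_coef (rho : nat -> R) (n k : nat) : R :=
  if n is n'.+1 then rho k + (q k)%:R * mean_coef rho n' k.+1 else 0.

Fixpoint slope_coef (rho : nat -> R) (n k : nat) : R :=
  if n is n'.+1 then mean_coef rho n k + slope_coef rho n' k.+1 else 0.

Lemma mean_coef_ge0 rho n k : (forall i, 0 <= rho i) -> 0 <= mean_coef rho n k.
Proof.
move=> r0; elim: n k => [|n IH] k //=.
by rewrite addr_ge0// mulr_ge0.
Qed.

Lemma slope_coef_ge rho n k : (forall i, 0 <= rho i) ->
  rho k <= slope_coef rho n.+1 k.
Proof.
move=> r0; rewrite /= -addrA lerDl addr_ge0//.
  by rewrite mulr_ge0// mean_coef_ge0.
elim: n k => [|n IH] k //=.
by rewrite addr_ge0// -/(mean_coef rho n.+1 k.+1) mean_coef_ge0.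
Qed.

(** Harmonicity at [u] expresses the sum of the increments to the children by the
increment from the parent of [u], so two numbers propagate down the levels. *)
Lemma psum_harmonic rho h n u : harmonic_fun adj h -> u != o ->
  psum n (fun y => h y * rho (lev y)) u =
  mean_coef rho n (lev u) * h (par u) + slope_coef rho n (lev u) * (h u - h (par u)).
Proof.
move=> /harmonic_balance hh; elim: n u => [|n IH] u u0; first by rewrite /= !mul0r addr0.
have -> : psum n.+1 (fun y => h y * rho (lev y)) u = h u * rho (lev u) +
    \sum_(v <- ch u) (mean_coef rho n (lev u).+1 * h u +
      slope_coef rho n (lev u).+1 * (h v - h u)).
  rewrite /=; congr (_ + _); rewrite big_seq [RHS]big_seq; apply: eq_bigr => v vu.
  by have [v0 pv lv] := chP T vu; rewrite IH// lv pv.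
rewrite big_split/= (sum_ch_const T) -mulr_sumr.
have : balance h u = 0 by [].
rewrite /balance (negbTE u0) => /eqP; rewrite addr_eq0 opprB => /eqP ->.
ring.
Qed.

Lemma psum_harmonic_origin rho h n : harmonic_fun adj h ->
  psum n.+1 (fun y => h y * rho (lev y)) o =
  h o * (rho 0%N + (q 0)%:R * mean_coef rho n 1).
Proof.
move=> hh; have /(_ o) := proj1 (harmonic_balance _) hh.
rewrite /balance eqxx addr0 => bo.
have -> : psum n.+1 (fun y => h y * rho (lev y)) o = h o * rho 0%N +
    \sum_(v <- ch o) (mean_coef rho n 1 * h o + slope_coef rho n 1 * (h v - h o)).
  rewrite /= (level_origin T); congr (_ + _).
  rewrite big_seq [RHS]big_seq; apply: eq_bigr => v vo.
  have [v0 pv lv] := chP T vo.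
  by rewrite psum_harmonic// lv pv (level_origin T).
rewrite big_split/= (sum_ch_const T) -mulr_sumr bo (level_origin T).
ring.
Qed.

Hypothesis mu1 : measure_of mu [set: X] = 1%E.

Lemma esum_mass : (\esum_(x in [set: X]) (mu x)%:E = 1)%E.
Proof. exact: mu1. Qed.

Lemma bounded_Lp2 (g : X -> R) (b : R) : (forall x, `|g x| <= b) ->
  Lp mu 2 (fun=> 1) g.
Proof.
move=> gb; apply: poweR_lty.
apply: (@le_lt_trans _ _ (\esum_(x in [set: X]) ((b `^ 2)%:E * (mu x)%:E))%E).
  apply: le_esum => x _; rewrite mulr1 -EFinM lee_fin ler_wpM2r ?(ltW (mass_gt0 x))//.
  apply: ge0_ler_powR; rewrite ?nnegrE// ?ler0n//.
  exact: le_trans (gb x).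
rewrite ge0_esumZl ?powR_ge0//; last by move=> x _; rewrite lee_fin ltW ?mass_gt0.
by rewrite esum_mass mule1 ltry.
Qed.

Lemma Lp2_summable h : Lp mu 2 (fun=> 1) h ->
  (\esum_(x in [set: X]) `|h x * mu x|%:E < +oo)%E.
Proof.
have h2 : (2 : R)^-1 != 0 by rewrite invr_neq0// pnatr_eq0.
move=> /(lty_poweRy h2) hfin.
apply: (@le_lt_trans _ _ (\esum_(x in [set: X])
   ((`|h x| `^ 2 * 1 * mu x)%:E + (mu x)%:E))%E).
  apply: le_esum => x _; rewrite -EFinD lee_fin mulr1 powR_mulrn//.
  rewrite normrM (gtr0_norm (mass_gt0 x)) -[X in _ + X]mul1r -mulrDl.
  rewrite ler_wpM2r ?(ltW (mass_gt0 x))//.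
  have := sqr_ge0 (`|h x| - 1); have := normr_ge0 (h x); nra.
rewrite esumD; first by rewrite esum_mass lte_add_pinfty// ltry.
- by move=> x _; rewrite lee_fin mulr_ge0 ?mulr1 ?powR_ge0// ltW ?mass_gt0.
- by move=> x _; rewrite lee_fin ltW ?mass_gt0.
Qed.

Variable K : X -> X -> R.
Hypothesis HK : reproducing_kernel adj mu K.

Let K_harmonic x : harmonic_fun adj (K x). Proof. by case: HK => /(_ x)[]. Qed.

Let K_summable x : (\esum_(y in [set: X]) `|K x y * mu y|%:E < +oo)%E.
Proof. by apply: Lp2_summable; case: HK => /(_ x)[]. Qed.

Let bump_summable x u :
  (\esum_(y in [set: X]) `|bump_fun u y * K x y * mu y|%:E < +oo)%E.
Proof.
apply: (@le_lt_trans _ _ (\esum_(y in [set: X]) (2%:E * `|K x y * mu y|%:E))%E).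
  apply: le_esum => y _; rewrite -EFinM lee_fin -mulrA normrM ler_wpM2r//.
  have /andP[b0 b1] := bump_bounds u y; rewrite ger0_norm//.
  by apply: (le_trans b1); rewrite ler_piMr ?ler0n// lern1 leq_b1.
rewrite ge0_esumZl ?ler0n//.
by rewrite lte_mul_pinfty ?lee_fin ?ler0n ?K_summable.
Qed.

Definition bump_weight (k i : nat) : R := phi k.-1 (i - k.-1) * level_mass i.

Let ssum_bump x u : u != o ->
  exists2 l, ssum [set: X] (fun y => bump_fun u y * K x y * mu y) = l%:E &
  (fun n => mean_coef (bump_weight (lev u)) n (lev u) * K x (par u) +
     slope_coef (bump_weight (lev u)) n (lev u) * (K x u - K x (par u))) @ \oo --> l.
Proof.
move=> u0.
have : (\esum_(y in S u) `|bump_fun u y * K x y * mu y|%:E < +oo)%E.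
  apply: le_lt_trans (bump_summable x u); rewrite esum_mkcond; apply: le_esum => y _.
  by case: ifP.
move=> /(ssum_psum T)[l le lcvg]; exists l.
  by rewrite -le; apply: ssum_support => y uy; rewrite bump_out// !mul0r.
apply: cvg_trans lcvg; apply: near_eq_cvg; apply: nearW => n.
rewrite /= -psum_harmonic//; apply: (eq_psum T) => y uy.
by rewrite bump_in// mass_level /bump_weight; ring.
Qed.

(** The reproducing property, tested on the difference of the bump functions of
[u] and [u'], turns [K x u - K x u'] into the value of that difference at [x]. *)
Lemma kernel_siblings x v u u' : u \in ch v -> u' \in ch v ->
  level_mass (lev u) * `|K x u - K x u'| <=
  2 * ((`[< S u x >])%:R + (`[< S u' x >])%:R).
Proof.
move=> /(chP T)[u0 pu lu] /(chP T)[u'0 pu' lu'].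
pose g y := bump_fun u y - bump_fun u' y.
have gA2 : bergman_space adj mu g.
  split; first by apply: harmonic_bump_sub => //; rewrite pu pu'.
  apply: (@bounded_Lp2 _ 2) => y; rewrite /g.
  have b (w : X) : 0 <= bump_fun w y <= 2.
    have /andP[b0 b1] := bump_bounds w y; rewrite b0/=.
    by apply: (le_trans b1); rewrite ler_piMr ?ler0n// lern1 leq_b1.
  by rewrite ler_norml; have := b u; have := b u'; lra.
have := proj2 HK g gA2 x; rewrite /inner => gE.
have [l1 e1 c1] := ssum_bump x u0.
have [l2 e2 c2] := ssum_bump x u'0.
have gl : g x = l1 - l2.
  have gsum : (\esum_(y in S o) `|g y * K x y * mu y|%:E < +oo)%E.
    rewrite (sector_originT T).
    apply: (@le_lt_trans _ _ (\esum_(y in [set: X])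
       (`|bump_fun u y * K x y * mu y|%:E + `|bump_fun u' y * K x y * mu y|%:E))%E).
      apply: le_esum => y _; rewrite -EFinD lee_fin /g !mulrBl.
      exact: ler_normB.
    by rewrite esumD// lte_add_pinfty ?bump_summable.
  have bsum w : (\esum_(y in S o) `|bump_fun w y * K x y * mu y|%:E < +oo)%E.
    by rewrite (sector_originT T).
  have [l le lcvg] := ssum_psum T gsum.
  have [l1' e1' c1'] := ssum_psum T (bsum u).
  have [l2' e2' c2'] := ssum_psum T (bsum u').
  move: le e1' e2'; rewrite (sector_originT T) e1 e2 -gE => -[->] [->] [->].
  rewrite -(cvg_lim (@Rhausdorff R) lcvg).
  rewrite -(cvg_lim (@Rhausdorff R) (cvgB c1' c2')).
  congr (lim (_ @ \oo)); apply/funext => n.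
  rewrite [RHS](_ : _ = psum n (fun y => bump_fun u y * K x y * mu y) o -
    psum n (fun y => bump_fun u' y * K x y * mu y) o)//.
  rewrite -psumB; apply: (eq_psum T) => y _.
  by rewrite /g; ring.
rewrite lu' pu' in c2; rewrite lu pu in c1 *.
set rho := bump_weight _ in c1 c2.
have gcvg : (fun n => `|slope_coef rho n (lev v).+1 * (K x u - K x u')|) @ \oo -->
    `|g x|.
  rewrite gl; apply: cvg_trans (cvg_norm (cvgB c1 c2)).
  apply: near_eq_cvg; apply: nearW => n; congr `|_|.
  rewrite [LHS](_ : _ = mean_coef rho n (lev v).+1 * K x v +
      slope_coef rho n (lev v).+1 * (K x u - K x v) - (mean_coef rho n (lev v).+1 * K x v +
      slope_coef rho n (lev v).+1 * (K x u' - K x v)))//.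
  by ring.
have rho0 j : 0 <= rho j.
  by rewrite /rho /bump_weight mulr_ge0 ?(ltW (level_mass_gt0 _))//; have /andP[] := phi_bounds (lev v) (j - lev v).
apply: (@le_trans _ _ `|g x|).
  apply: (cvgr_to_ge gcvg); exists 1%N => // n /= n1.
  rewrite normrM.
  rewrite ler_wpM2r//; apply: le_trans (ler_norm _).
  case: n n1 => // n _; apply: le_trans (slope_coef_ge _ _ rho0).
  by rewrite /rho /bump_weight subSnn /= mul0r addr0 mul1r.
rewrite /g; apply: (le_trans (ler_normB _ _)).
have b w : `|bump_fun w x| <= 2 * (`[< S w x >])%:R.
  by have /andP[b0 b1] := bump_bounds w x; rewrite ger0_norm.
by rewrite mulrDr lerD.
Qed.

Lemma kernel_origin x : level_mass 0 * `|K x o| <= 1.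
Proof.
have gA2 : bergman_space adj mu (fun=> 1 : R).
  split; last by apply: (@bounded_Lp2 _ 1) => y; rewrite normr1.
  apply/harmonic_balance => y; rewrite /balance subrr big1 ?add0r ?if_same//.
have := proj2 HK _ gA2 x; rewrite /inner => gE.
have : (\esum_(y in S o) `|K x y * mu y|%:E < +oo)%E by rewrite (sector_originT T).
move=> /(ssum_psum T)[l]; rewrite (sector_originT T).
have -> : (fun y => K x y * mu y) = (fun y => 1 * K x y * mu y).
  by apply/funext => y; rewrite mul1r.
rewrite -gE => -[<-] /cvg_norm; rewrite normr1 => gcvg.
apply: (cvgr_to_ge gcvg); exists 1%N => // n /= n1.
case: n n1 => // n _.
have -> : psum n.+1 (fun y => 1 * K x y * mu y) o =
    psum n.+1 (fun y => K x y * level_mass (lev y)) o.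
  by apply: (eq_psum T) => y _; rewrite mul1r.
have lm j : 0 <= level_mass j by rewrite ltW ?level_mass_gt0.
rewrite psum_harmonic_origin// normrM mulrC ler_wpM2l//.
apply: le_trans (ler_norm _); rewrite lerDl mulr_ge0//.
exact: mean_coef_ge0.
Qed.

Let near x v : R := (`[< S v x >])%:R / mu v.
Let below x v : R := (`[< psector v x >])%:R / child_mass v.

Let jump x y : R := if y == o then 0 else K x y - K x (par y).

(** The increments from [v] to its children differ only if [x] lies below [v], by
[kernel_siblings], and their sum is the increment from the parent of [v] to [v];
dividing by the number of children, which is at least 2, halves the latter. *)
Lemma kernel_jump x v u : u \in ch v ->
  `|jump x u| <= `|jump x v| / 2 + 2 * near x u + 2 * below x v.
Proof.
move=> uv; have [u0 pu lu] := chP T uv.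
have Q0 := q_gt0 (lev v); set Q : R := (q (lev v))%:R in Q0 *.
have M0 := level_mass_gt0 (lev v).+1; set M := level_mass _ in M0 *.
have bal : \sum_(u' <- ch v) (K x u' - K x v) = jump x v.
  have := proj1 (harmonic_balance _) (K_harmonic x) v.
  rewrite /balance /jump; case: ifP => _; first by rewrite addr0.
  by move=> /eqP; rewrite addr_eq0 opprB => /eqP.
have jE : Q * jump x u = jump x v + \sum_(u' <- ch v) (K x u - K x u').
  rewrite -bal -big_split/= /jump (negbTE u0) pu -(sum_ch_const T).
  by apply: eq_bigr => u' _; ring.
have sib : `|\sum_(u' <- ch v) (K x u - K x u')| <=
    2 / M * (Q * (`[< S u x >])%:R + (`[< psector v x >])%:R).
  apply: (le_trans (ler_norm_sum _ _ _)).
  rewrite (psector_ch R T) -(sum_ch_const T) -big_split/= mulr_sumr big_seq [leRHS]big_seq.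
  apply: ler_sum => u' u'v.
  have := kernel_siblings x uv u'v; rewrite lu -/M => H.
  by rewrite mulrAC ler_pdivlMr// mulrC.
have nE : near x u = (`[< S u x >])%:R / M by rewrite /near mass_level lu.
have bE : below x v = (`[< psector v x >])%:R / (Q * M) by [].
rewrite -(ler_pM2l Q0) -[X in X * `|_|](gtr0_norm Q0) -normrM jE.
apply: (le_trans (ler_normD _ _)); apply: (le_trans (lerD (lexx _) sib)).
have -> : Q * (`|jump x v| / 2 + 2 * near x u + 2 * below x v) =
  Q / 2 * `|jump x v| + 2 / M * (Q * (`[< S u x >])%:R + (`[< psector v x >])%:R).
  by rewrite nE bE; field; rewrite !lt0r_neq0.
rewrite lerD2r ler_peMl// ler_pdivlMr// mul1r; exact: q_ge2.
Qed.

(** The jumps of the kernel along the path from the origin to [y] are halved at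
every step, apart from the contributions of [kernel_jump]; summing them up leaves
one term for each sector and each punctured sector containing both points. *)
Lemma kernel_bound x y : (`|K x y|%:E <=
  4%:E * (\esum_(v in ancestors y) ((`[< S v x >])%:R / mu v)%:E +
          \esum_(v in pancestors y) ((`[< psector v x >])%:R / child_mass v)%:E))%E.
Proof.
have near0 v : (0 <= (near x v)%:E)%E by rewrite lee_fin divr_ge0// ltW ?mass_gt0.
have below0 v : (0 <= (below x v)%:E)%E.
  by rewrite lee_fin divr_ge0// mulr_ge0// ltW ?level_mass_gt0.
apply: (@le_trans _ _ (`|K x y| + `|jump x y|)%:E); first by rewrite lee_fin lerDl.
move ly : (lev y) => n; elim: n y ly => [|n IH] y ly.
  have /eqP -> : y == o by rewrite -(level_eq0 T) ly.
  rewrite esum_ancestors// (pancestors_origin T) !esum_set0 !adde0.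
  rewrite /jump eqxx normr0 addr0 -EFinM lee_fin.
  have -> : `[< S o x >] by apply/asboolP/(sector_origin T).
  have := kernel_origin x; rewrite mulrA ler_pdivlMr ?mass_gt0// mass_level (level_origin T) mulrC.
  by move=> /le_trans -> //; rewrite mulr1 ler1n.
have y0 : y != o by rewrite -(level_eq0 T) ly.
have lp : lev (par y) = n by move: ly; rewrite (level_par T y0) => -[].
have {}IH := IH _ lp.
rewrite esum_ancestors// (pancestors_par T)//.
rewrite (esum_ancestors adj o (par y) below0)//.
rewrite -addeA [X in (_ + X)%E]addeCA addeA ge0_muleDr; last 2 first.
- exact: adde_ge0 (near0 y) (below0 _).
- by apply: adde_ge0; apply: esum_ge0 => v _; [exact: near0|exact: below0].
apply: (@le_trans _ _ ((4 * (near x y + below x (par y)))%:E +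
    (`|K x (par y)| + `|jump x (par y)|)%:E)%E); last first.
  by rewrite leeD.
rewrite -EFinD lee_fin.
have := kernel_jump x (ch_par T y0).
have : `|K x y| <= `|K x (par y)| + `|jump x y|.
  have -> : K x y = K x (par y) + jump x y by rewrite /jump (negbTE y0); ring.
  exact: ler_normD.
have := normr_ge0 (jump x (par y)); lra.
Qed.

End Kernel.

(** * Weights *)

Section Bellman.
Variables (R : realType) (X : choiceType) (adj : rel X) (o : X) (q : nat -> nat).
Hypothesis T : radial_tree adj o q.

Notation lev := (level adj o).
Notation S := (sector adj o).
Notation ch := (ch adj o).
Notation psector := (psector adj o).

Variables (F TF : X -> R) (K : R).
Hypothesis F0 : forall x, 0 < F x.
Hypothesis TF0 : forall x, 0 < TF x.
Hypothesis K0 : 0 < K.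
Hypothesis TF_rec : forall v, TF v = F v + \sum_(u <- ch v) TF u.
Hypothesis TF_le : forall v, TF v <= K * F v.

Let lam := 1 + (2 * K)^-1.
Let lam0 : 0 < lam. Proof. by rewrite /lam addr_gt0// invr_gt0 mulr_gt0. Qed.

(** Comparability with the vertex makes the part of [TF v] at distance [j] decay
exponentially in [j], so that a small growth rate [lam] is affordable.  The
factor 2 reproduces itself in the induction over the truncation level because
[lam - 1] is half of [K^-1]. *)
Lemma esum_sector_geometric k v : (k <= lev v)%N ->
  (\esum_(y in S v) (F y * lam ^+ (lev y - k))%:E <=
   (2 * lam ^+ (lev v - k) * TF v)%:E)%E.
Proof.
move=> kv; apply: (esum_sector_le T) => [x|n].
  by rewrite mulr_ge0 ?exprn_ge0 ?(ltW lam0) ?(ltW (F0 x)).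
rewrite lee_fin; elim: n v kv => [|n IH] v kv.
  by rewrite !mulr_ge0 ?exprn_ge0 ?(ltW lam0) ?(ltW (TF0 v)).
apply: (@le_trans _ _ (F v * lam ^+ (lev v - k) +
    \sum_(u <- ch v) 2 * lam ^+ (lev v - k).+1 * TF u)).
  rewrite /= lerD2l big_seq [leRHS]big_seq; apply: ler_sum => u /(chP T)[_ _ lu].
  have ku : (k <= lev u)%N by rewrite lu (leq_trans kv).
  by have := IH u ku; rewrite lu subSn.
rewrite -mulr_sumr (_ : \sum_(u <- ch v) TF u = TF v - F v); last first.
  by rewrite (TF_rec v) addrC addKr.
rewrite exprSr; set L := lam ^+ _.
have L0 : 0 < L by rewrite exprn_gt0.
have h : (2 * K)^-1 * TF v <= F v / 2.
  rewrite invfM -mulrA mulrC ler_pM2r ?invr_gt0//.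
  by rewrite mulrC ler_pdivrMr// mulrC.
have -> : F v * L + 2 * (L * lam) * (TF v - F v) =
  L * (F v + 2 * lam * (TF v - F v)) by ring.
have -> : 2 * L * TF v = L * (2 * TF v) by ring.
rewrite ler_pM2l//.
have -> : F v + 2 * lam * (TF v - F v) = 2 * TF v - F v +
  2 * ((2 * K)^-1 * TF v) - 2 * ((2 * K)^-1 * F v).
  by rewrite /lam; ring.
have : 0 <= (2 * K)^-1 * F v by rewrite mulr_ge0 ?(ltW (F0 v))// invr_ge0 mulr_ge0// ltW.
lra.
Qed.

Lemma sector_geometric v :
  (\esum_(y in S v) (F y * lam ^+ (lev y - lev v))%:E <= (4 * TF v)%:E)%E.
Proof.
apply: (le_trans (esum_sector_geometric (leqnn _))).
by rewrite lee_fin subnn expr0 mulr1 ler_pM2r// ler_nat.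
Qed.

Lemma psector_geometric v : 1 <= K ->
  (\esum_(y in psector v) (F y * lam ^+ (lev y - lev v))%:E <=
   (4 * \sum_(u <- ch v) TF u)%:E)%E.
Proof.
move=> K1; rewrite (esum_psector T)//; last first.
  by move=> y; rewrite lee_fin mulr_ge0 ?exprn_ge0 ?(ltW lam0) ?(ltW (F0 y)).
rewrite mulr_sumr -sumEFin big_seq [leRHS]big_seq; apply: lee_sum => u /(chP T)[_ _ lu].
apply: (@le_trans _ _ (2 * lam ^+ (lev u - lev v) * TF u)%:E).
  by apply: esum_sector_geometric; rewrite lu.
rewrite lu subSnn expr1 lee_fin ler_pM2r// /lam.
have : (2 * K)^-1 <= 1 by rewrite invf_le1 ?mulr_gt0//; move: K1; lra.
lra.
Qed.

Lemma ancestors_geometric (r : R) x : 0 < r < 1 ->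
  (\esum_(v in [set v | S v x]) (r ^+ (lev x - lev v))%:E <= ((1 - r)^-1)%:E)%E.
Proof.
move=> /andP[r0 r1].
have p0 (y v : X) : (0 <= (r ^+ (lev y - lev v))%:E)%E by rewrite lee_fin exprn_ge0// ltW.
have r'0 : 0 < 1 - r by rewrite subr_gt0.
have -> : ((1 - r)^-1 = 1 + r * (1 - r)^-1) by field; exact: lt0r_neq0.
move lx : (lev x) => n; elim: n x lx => [|n IH] x lx.
  rewrite -lx -[X in esum X]/(ancestors adj o x) (esum_ancestors adj o)//.
  have /eqP -> : x == o by rewrite -(level_eq0 T) lx.
  rewrite (pancestors_origin T) esum_set0 adde0 subnn expr0 lee_fin lerDl.
  by rewrite mulr_ge0 ?invr_ge0// ltW.
rewrite -lx -[X in esum X]/(ancestors adj o x) (esum_ancestors adj o)//.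
rewrite subnn expr0 EFinD leeD2l//.
have x0 : x != o by rewrite -(level_eq0 T) lx.
have lp : lev (pred_vertex adj o x) = n by move: lx; rewrite (level_par T x0) => -[].
rewrite (pancestors_par T x0).
have -> : ((1 - r)^-1 = 1 + r * (1 - r)^-1) by field; exact: lt0r_neq0.
apply: (@le_trans _ _ (r%:E * \esum_(v in ancestors adj o (pred_vertex adj o x))
   (r ^+ (n - lev v))%:E)%E).
  rewrite -ge0_esumZl ?(ltW r0)//.
  apply: le_esum => v vx; rewrite -EFinM -exprS lee_fin -subSn; first by rewrite lx.
  by rewrite -lp; exact: (sector_level T vx).
  by move=> v _; rewrite -lp.
rewrite EFinM lee_wpmul2l ?lee_fin ?(ltW r0)//.
exact: IH.
Qed.

End Bellman.

(** The constant of [geometric_family_bound] for the ratio [lam], the factor 4 of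
the geometric estimates and the geometric series for [G]. *)
Definition family_const (R : realType) (p lam B : R) : R :=
  (1 - lam `^ (- (p - 1)^-1))^-1 `^ (p - 1) * 4 *
  (4 `^ (p - 1) * B * (1 - lam `^ (- (p - 1)))^-1).

(** Bounds the ratio of the weight of a sector to the weight of its vertex, for a
weight with constant [b] and for its dual weight. *)
Definition doubling_const (R : realType) (alpha p b : R) : R :=
  1 + mass_ratio alpha * (b + b `^ (p - 1)^-1).

Definition decay_ratio (R : realType) (alpha p b : R) : R :=
  1 + (2 * doubling_const alpha p b)^-1.

Definition sector_const (R : realType) (alpha p b : R) : R :=
  let k := doubling_const alpha p b in
  family_const p (decay_ratio alpha p b) (k * k `^ (p - 1)).

Definition psector_const (R : realType) (alpha p b : R) : R :=
  family_const p (decay_ratio alpha p b) (mass_ratio alpha `^ p * (b + 1)).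

Section Weights.
Variables (R : realType) (X : choiceType) (adj : rel X) (o : X) (q : nat -> nat).
Hypothesis T : radial_tree adj o q.
Variables (alpha c : R).
Hypothesis alpha1 : 1 < alpha.
Hypothesis c0 : 0 < c.

Notation lev := (level adj o).
Notation S := (sector adj o).
Notation ch := (ch adj o).
Notation psector := (psector adj o).
Notation mu := (mass adj o q alpha c).

Variables (p : R) (w : X -> R).
Hypothesis p1 : 1 < p.
Hypothesis wBp : Bp adj o mu p w.

Let b := fine (Bp_const adj o mu p w).
Let sig x := w x `^ (- (p - 1)^-1).
Let C0 : R := mass_ratio alpha.

Let p0 : 0 < p. Proof. by move: p1; lra. Qed.
Let pm0 : 0 < p - 1. Proof. by move: p1; lra. Qed.
Let w0 x : 0 < w x. Proof. by case: wBp. Qed.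
Let sig0 x : 0 < sig x. Proof. exact: powR_gt0. Qed.
Let mu0 x : 0 < mu x. Proof. exact: (mass_gt0 T). Qed.
Let C00 : 0 < C0. Proof. exact: mass_ratio_gt0. Qed.

Lemma Bp_pair Q A U : dyadic adj o Q -> Q <> [set: X] -> dyadic adj o A ->
  A <> [set: X] -> dyadic_parent adj o Q U -> dyadic_parent adj o A U ->
  (((fine (measure_of mu Q))^-1)%:E * (\esum_(x in Q) (w x * mu x)%:E) *
   poweR (((fine (measure_of mu A))^-1)%:E * \esum_(x in A) (sig x * mu x)%:E) (p - 1)
   <= b%:E)%E.
Proof.
move=> dQ nQ dA nA QU AU.
set z := (_ * poweR _ _)%E.
have zle : (z <= Bp_const adj o mu p w)%E.
  apply: ereal_sup_ubound; exists Q, A, U; split => //.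
  rewrite /average /= !ssum_ge0 ?(conj_exp_div p1) ?(div_conj_exp p1)//.
    by move=> x; rewrite mulr_ge0 ?powR_ge0 ?(ltW (mu0 x)).
  by move=> x; rewrite mulr_ge0 ?(ltW (w0 x)) ?(ltW (mu0 x)).
have z0 : (0 <= z)%E.
  rewrite !mule_ge0 ?poweR_ge0//.
    rewrite lee_fin invr_ge0 fine_ge0//; apply: esum_ge0 => x _.
    by rewrite lee_fin ltW.
  by apply: esum_ge0 => x _; rewrite lee_fin mulr_ge0 ?(ltW (w0 x)) ?(ltW (mu0 x)).
rewrite fineK// fin_numE; apply/andP; split.
  by rewrite gt_eqF// (lt_le_trans _ (le_trans z0 zle)).
by rewrite lt_eqF//; case: wBp.
Qed.

Let Mu u := fine (measure_of mu (S u)).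

Let measure_sector u : measure_of mu (S u) = (Mu u)%:E.
Proof.
rewrite fineK// ge0_fin_numE.
  exact: le_lt_trans (sector_mass_le T alpha1 c0 u) (ltry _).
by apply: esum_ge0 => x _; rewrite lee_fin ltW.
Qed.

Let Mu_le u : Mu u <= C0 * mu u.
Proof. by rewrite -lee_fin -measure_sector; exact: sector_mass_le. Qed.

Let Mu_gt0 u : 0 < Mu u.
Proof.
apply: (lt_le_trans (mu0 u)); rewrite -lee_fin -measure_sector.
apply: esum_ge; exists [set u]; first by split => // _ ->; exact: sector_refl.
by rewrite fsbig_set1.
Qed.

Let measure_set1 v : fine (measure_of mu [set v]) = mu v.
Proof. by rewrite /measure_of esum_set1// lee_fin ltW. Qed.

Let dS u : dyadic adj o (S u). Proof. by exists u; left. Qed.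
Let d1 u : dyadic adj o [set u]. Proof. by exists u; right. Qed.
Let nS u : u != o -> S u <> [set: X].
Proof.
move=> u0 uT; have : S u o by rewrite uT.
by move=> /(sectorE T)[ou|[]]; [rewrite ou eqxx in u0|rewrite eqxx].
Qed.

Let chpar v u : u \in ch v -> dyadic_parent adj o (S u) (S v).
Proof. by move=> /(chP T)[u0 <- _]; apply: dyadic_parent_sector. Qed.

Let chT v u : u \in ch v -> S u <> [set: X].
Proof. by move=> /(chP T)[u0 _ _]; exact: nS. Qed.

Let set1T v u : u \in ch v -> [set v] <> [set: X].
Proof.
move=> uv vT; have : [set v] u by rewrite vT.
by move=> uv'; have [_ _] := chP T uv; rewrite uv' => /eqP; rewrite -addn1 -[X in X == _]addn0 eqn_add2l.
Qed.

Let b0 v u : u \in ch v -> 0 <= b.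
Proof.
move=> uv; rewrite -lee_fin; apply: le_trans (Bp_pair (d1 v) (set1T uv) (d1 v) (set1T uv)
  (dyadic_parent_singleton _ _ v) (dyadic_parent_singleton _ _ v)).
rewrite !mule_ge0 ?poweR_ge0 ?lee_fin ?invr_ge0 ?measure_set1 ?(ltW (mu0 _))//.
by apply: esum_ge0 => x _; rewrite lee_fin mulr_ge0 ?(ltW (w0 x)) ?(ltW (mu0 x)).
Qed.

Let W1 v : (((fine (measure_of mu [set v]))^-1)%:E *
  (\esum_(x in [set v]) (w x * mu x)%:E) = (w v)%:E)%E.
Proof.
rewrite measure_set1 esum_set1; last by rewrite lee_fin mulr_ge0 ?(ltW (w0 v)) ?(ltW (mu0 v)).
by rewrite -EFinM mulrC mulfK// lt0r_neq0.
Qed.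

Let S1 v : (((fine (measure_of mu [set v]))^-1)%:E *
  (\esum_(x in [set v]) (sig x * mu x)%:E) = (sig v)%:E)%E.
Proof.
rewrite measure_set1 esum_set1; last by rewrite lee_fin mulr_ge0 ?(ltW (sig0 v)) ?(ltW (mu0 v)).
by rewrite -EFinM mulrC mulfK// lt0r_neq0.
Qed.

Let sigp v : sig v `^ (p - 1) = (w v)^-1.
Proof.
by rewrite /sig -powRrM mulNr mulVf ?lt0r_neq0// powR_inv1// ltW.
Qed.

Let EW v := (\esum_(x in S v) (w x * mu x)%:E)%E.
Let ES v := (\esum_(x in S v) (sig x * mu x)%:E)%E.

Let EW0 v : (0 <= EW v)%E.
Proof. by apply: esum_ge0 => x _; rewrite lee_fin mulr_ge0 ?(ltW (w0 x)) ?(ltW (mu0 x)). Qed.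
Let ES0 v : (0 <= ES v)%E.
Proof. by apply: esum_ge0 => x _; rewrite lee_fin mulr_ge0 ?(ltW (sig0 x)) ?(ltW (mu0 x)). Qed.

(** The admissible pair consists of [S u] and the singleton of its parent. *)
Let EW_le v u : u \in ch v -> (EW u <= (b * C0 * w v * mu u)%:E)%E.
Proof.
move=> uv; have := Bp_pair (dS u) (chT uv) (d1 v) (set1T uv) (chpar uv)
  (dyadic_parent_singleton _ _ v).
rewrite -/(Mu u) -/(EW u) S1 poweR_EFin sigp muleAC -EFinM -invfM.
rewrite lee_pdivrMl ?mulr_gt0// => /le_trans; apply.
rewrite -EFinM lee_fin.
have bw : 0 <= b * w v by rewrite mulr_ge0 ?(b0 uv) ?(ltW (w0 v)).
by have := ler_wpM2l bw (Mu_le u); congr (is_true (_ <= _)); ring.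
Qed.

(** The same pair in the other order. *)
Let ES_le v u : u \in ch v -> (ES u <= (b `^ (p - 1)^-1 * C0 * sig v * mu u)%:E)%E.
Proof.
move=> uv; have := Bp_pair (d1 v) (set1T uv) (dS u) (chT uv)
  (dyadic_parent_singleton _ _ v) (chpar uv).
rewrite -/(Mu u) -/(ES u) W1.
rewrite -lee_pdivlMl// => /(gt0_ler_poweR (r := (p - 1)^-1)).
rewrite invr_ge0 (ltW pm0) => /(_ isT).
have i1 : (poweR ((Mu u)^-1%:E * ES u) (p - 1))%E \in `[0%E, +oo%E].
  by rewrite in_itv/= poweR_ge0 leey.
have i2 : (((w v)^-1)%:E * b%:E)%E \in `[0%E, +oo%E].
  by rewrite in_itv/= leey -EFinM lee_fin mulr_ge0 ?invr_ge0 ?(ltW (w0 v)) ?(b0 uv).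
move=> /(_ i1 i2).
rewrite -poweRrM mulfV ?lt0r_neq0// poweRe1; last first.
  by rewrite mule_ge0// lee_fin invr_ge0 ltW.
rewrite lee_pdivrMl// => /le_trans; apply.
rewrite -[((w v)^-1%:E * b%:E)%E]EFinM poweR_EFin -EFinM lee_fin powRM ?invr_ge0 ?(ltW (w0 v)) ?(b0 uv)//.
have -> : (w v)^-1 `^ (p - 1)^-1 = sig v.
  by rewrite /sig powRN -(powR_inv1 (ltW (w0 v))) powRAC powR_inv1 ?powR_ge0.
have -> : b `^ (p - 1)^-1 * C0 * sig v * mu u = (C0 * mu u) * (sig v * b `^ (p - 1)^-1) by ring.
by rewrite ler_wpM2r// mulr_ge0 ?powR_ge0 ?(ltW (sig0 v)).
Qed.

Let Kb : R := doubling_const alpha p b.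

Let bge0 : 0 <= b.
Proof. by have [u uo] := ex_ch T o; exact: b0 uo. Qed.

Let child_mass_le_mass v : child_mass adj o q alpha c v <= mu v.
Proof.
apply: (le_trans (child_mass_le T alpha1 c0 v)).
rewrite ler_piMl ?(ltW (mu0 v))// -subr_ge0 ltW//.
exact: mass_ratio_base.
Qed.

Let sum_bound (H : X -> R) (E : X -> \bar R) (k : R) v : 0 <= k -> (forall x, 0 < H x) ->
  (forall v, 0 <= E v)%E ->
  (forall v u, u \in ch v -> (E u <= (k * C0 * H v * mu u)%:E)%E) ->
  (forall v, E v = (H v * mu v)%:E + \sum_(u <- ch v) E u)%E ->
  [/\ E v = (fine (E v))%:E, 0 < fine (E v), fine (E v) <= (1 + C0 * k) * (H v * mu v) &
   fine (E v) = H v * mu v + \sum_(u <- ch v) fine (E u)].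
Proof.
move=> k0 H0 E0 Ele Erec.
have Efin x : E x \is a fin_num.
  rewrite Erec fin_numD/= sum_fin_num; apply/allP => _ /mapP[u u'x ->] /=.
  rewrite ge0_fin_numE//; move: u'x; rewrite mem_filter /= => u'x.
  by apply: (le_lt_trans (Ele _ _ u'x)); rewrite ltry.
have e : fine (E v) = H v * mu v + \sum_(u <- ch v) fine (E u).
  apply: EFin_inj; rewrite EFinD -sumEFin fineK// Erec; congr (_ + _)%E.
  by apply: eq_bigr => u _; rewrite fineK.
split => //; first by rewrite fineK.
  rewrite e; apply: (lt_le_trans (mulr_gt0 (H0 v) (mu0 v))).
  rewrite lerDl sumr_ge0// => u _; by rewrite fine_ge0.
rewrite e mulrDl mul1r lerD2l.
apply: (@le_trans _ _ (\sum_(u <- ch v) k * C0 * H v * mu u)).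
  rewrite big_seq [leRHS]big_seq; apply: ler_sum => u uv.
  by rewrite -lee_fin fineK//; exact: Ele.
rewrite -mulr_sumr (sum_ch_mass T).
have -> : C0 * k * (H v * mu v) = k * C0 * H v * mu v by ring.
by rewrite ler_wpM2l// !mulr_ge0 ?(ltW (H0 v))// ltW.
Qed.

Let TW v := fine (EW v).
Let TS v := fine (ES v).

Let TWP v : [/\ EW v = (TW v)%:E, 0 < TW v, TW v <= (1 + C0 * b) * (w v * mu v) &
   TW v = w v * mu v + \sum_(u <- ch v) TW u].
Proof.
apply: (sum_bound v bge0 w0 EW0 EW_le) => x.
apply: (esum_sector T) => y.
by rewrite lee_fin mulr_ge0 ?(ltW (w0 y)) ?(ltW (mu0 y)).
Qed.

Let TSP v : [/\ ES v = (TS v)%:E, 0 < TS v,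
   TS v <= (1 + C0 * b `^ (p - 1)^-1) * (sig v * mu v) &
   TS v = sig v * mu v + \sum_(u <- ch v) TS u].
Proof.
apply: (sum_bound v (powR_ge0 _ _) sig0 ES0 ES_le) => x.
apply: (esum_sector T) => y.
by rewrite lee_fin mulr_ge0 ?(ltW (sig0 y)) ?(ltW (mu0 y)).
Qed.

Let Kb1 : 1 <= Kb.
Proof. by rewrite /Kb /doubling_const -/C0 lerDl mulr_ge0 ?addr_ge0 ?powR_ge0 ?bge0 ?(ltW C00). Qed.
Let Kb0 : 0 < Kb. Proof. by apply: lt_le_trans Kb1. Qed.

Let TW_le v : TW v <= Kb * (w v * mu v).
Proof.
have [_ _ h _] := TWP v; apply: (le_trans h).
rewrite ler_wpM2r ?(ltW (mulr_gt0 (w0 v) (mu0 v)))// /Kb /doubling_const -/C0 lerD2l.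
by rewrite ler_wpM2l ?(ltW C00)// lerDl powR_ge0.
Qed.

Let TS_le v : TS v <= Kb * (sig v * mu v).
Proof.
have [_ _ h _] := TSP v; apply: (le_trans h).
rewrite ler_wpM2r ?(ltW (mulr_gt0 (sig0 v) (mu0 v)))// /Kb /doubling_const -/C0 lerD2l.
by rewrite ler_wpM2l ?(ltW C00)// lerDr bge0.
Qed.

Let TW0 v : 0 < TW v. Proof. by have [] := TWP v. Qed.
Let TS0 v : 0 < TS v. Proof. by have [] := TSP v. Qed.

Let powR_split (x : R) : 0 < x -> x * x `^ (p - 1) = x `^ p.
Proof.
move=> x0; rewrite -[X in X * _]powRr1 ?ltW// -powRD; last first.
  by rewrite (negbTE (lt0r_neq0 x0)) implybT.
by congr (_ `^ _); ring.
Qed.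

(** Both weights of a sector are comparable to those of its vertex, where the
condition holds with equality. *)
Let Ap_sector v : TW v * TS v `^ (p - 1) <= Kb * Kb `^ (p - 1) * mu v `^ p.
Proof.
have h : TS v `^ (p - 1) <= (Kb * (sig v * mu v)) `^ (p - 1).
  by apply: ge0_ler_powR; rewrite ?nnegrE ?(ltW pm0) ?(ltW (TS0 v))
    ?(ltW (mulr_gt0 Kb0 (mulr_gt0 (sig0 v) (mu0 v))))//; exact: TS_le.
apply: (le_trans (ler_pM (ltW (TW0 v)) (powR_ge0 _ _) (TW_le v) h)).
rewrite (powRM _ (ltW Kb0) (ltW (mulr_gt0 (sig0 v) (mu0 v)))).
rewrite (powRM _ (ltW (sig0 v)) (ltW (mu0 v))) sigp.
rewrite -(powR_split (mu0 v)) le_eqVlt; apply/orP; left; apply/eqP.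
by field; exact: lt0r_neq0.
Qed.

Let Ap_siblings v u u' : u \in ch v -> u' \in ch v ->
  TW u * TS u' `^ (p - 1) <=
  (C0 `^ p * (b + 1)) * (level_mass q alpha c (lev v).+1) `^ p.
Proof.
move=> uv u'v; have [_ _ lu] := chP T uv; have [_ _ lu'] := chP T u'v.
have := Bp_pair (dS u) (chT uv) (dS u') (chT u'v) (chpar uv) (chpar u'v).
rewrite -/(Mu u) -/(EW u) -/(Mu u') -/(ES u').
have [-> _ _ _] := TWP u; have [-> _ _ _] := TSP u'.
rewrite -[((Mu u')^-1%:E * (TS u')%:E)%E]EFinM poweR_EFin -!EFinM lee_fin.
have mE : mu u = level_mass q alpha c (lev v).+1 by rewrite mass_level lu.
have mE' : mu u' = level_mass q alpha c (lev v).+1 by rewrite mass_level lu'.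
set m := level_mass _ _ _ _ in mE mE' *.
have m0 : 0 < m by rewrite -mE.
have Mm : Mu u <= C0 * m by rewrite -mE.
have Mm' : Mu u' <= C0 * m by rewrite -mE'.
move=> h.
have Mpow : Mu u' `^ (p - 1) <= (C0 * m) `^ (p - 1).
  by apply: ge0_ler_powR; rewrite ?nnegrE ?(ltW pm0) ?(ltW (Mu_gt0 u'))
    ?(ltW (mulr_gt0 C00 m0)).
have -> : TW u * TS u' `^ (p - 1) = ((Mu u)^-1 * TW u * ((Mu u')^-1 * TS u') `^ (p - 1)) *
    (Mu u * Mu u' `^ (p - 1)).
  rewrite powRM ?invr_ge0 ?(ltW (Mu_gt0 _)) ?(ltW (TS0 _))//.
  have -> : (Mu u')^-1 `^ (p - 1) = (Mu u' `^ (p - 1))^-1.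
    by rewrite -(powR_inv1 (ltW (Mu_gt0 u'))) powRAC powR_inv1 ?powR_ge0.
  have Mp0 : 0 < Mu u' `^ (p - 1) by rewrite powR_gt0.
  by field; rewrite !lt0r_neq0.
apply: (@le_trans _ _ (b * ((C0 * m) * (C0 * m) `^ (p - 1)))).
  apply: ler_pM => //.
  - rewrite !mulr_ge0 ?invr_ge0 ?powR_ge0 ?(ltW (Mu_gt0 _)) ?(ltW (TW0 _))//.
  - by rewrite mulr_ge0 ?powR_ge0 ?(ltW (Mu_gt0 _)).
  - by apply: ler_pM; rewrite ?powR_ge0 ?(ltW (Mu_gt0 _)).
rewrite (powR_split (mulr_gt0 C00 m0)) (powRM _ (ltW C00) (ltW m0)).
rewrite mulrCA mulrA ler_wpM2r ?powR_ge0// ler_wpM2l ?powR_ge0//.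
by rewrite lerDl.
Qed.

(** All children have the same mass, so the total weights are at most the number
of children times the weights of the heaviest children for [w] and for its dual;
these two sectors are siblings, to which [Ap_siblings] applies. *)
Let Ap_psector v : (\sum_(u <- ch v) TW u) * (\sum_(u <- ch v) TS u) `^ (p - 1) <=
  (C0 `^ p * (b + 1)) * child_mass adj o q alpha c v `^ p.
Proof.
have [u uv umax] := seq_argmax TW (ex_ch T v).
have [u' u'v u'max] := seq_argmax TS (ex_ch T v).
set Q : R := (q (lev v))%:R; have Q0 : 0 < Q by exact: q_gt0 T _.
have hW : \sum_(u <- ch v) TW u <= Q * TW u.
  by rewrite -(sum_ch_const T) big_seq [leRHS]big_seq; apply: ler_sum.
have hS : \sum_(u <- ch v) TS u <= Q * TS u'.
  by rewrite -(sum_ch_const T) big_seq [leRHS]big_seq; apply: ler_sum.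
have hS0 : 0 <= \sum_(u <- ch v) TS u by apply: sumr_ge0 => z _; exact: ltW.
have hSp : (\sum_(u <- ch v) TS u) `^ (p - 1) <= (Q * TS u') `^ (p - 1).
  by apply: ge0_ler_powR; rewrite ?nnegrE ?(ltW pm0) ?mulr_ge0 ?(ltW Q0) ?(ltW (TS0 _)).
have hW0 : 0 <= \sum_(u <- ch v) TW u by apply: sumr_ge0 => z _; exact: ltW.
apply: (le_trans (ler_pM hW0 (powR_ge0 _ _) hW hSp)).
rewrite powRM ?(ltW Q0) ?(ltW (TS0 _))// /child_mass -/Q.
rewrite powRM ?(ltW Q0) ?(ltW (level_mass_gt0 T _ c0 _))// -(powR_split Q0).
have := ler_wpM2l (ltW (mulr_gt0 Q0 (powR_gt0 (p - 1) Q0))) (Ap_siblings uv u'v).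
by congr (is_true (_ <= _)); ring.
Qed.

Variable f : X -> R.
Let N : \bar R := (\esum_(x in [set: X]) (`|f x| `^ p * w x * mu x)%:E)%E.

Let lam := decay_ratio alpha p b.
Let lam1 : 1 < lam.
Proof. by rewrite /lam ltrDl invr_gt0 mulr_gt0. Qed.

Let G (r : R) := (1 - r)^-1.
Let G0 (r : R) : 0 < r < 1 -> 0 < G r.
Proof. by move=> /andP[_ r1]; rewrite invr_gt0 subr_gt0. Qed.

Lemma sector_family_bound :
  (\esum_(x in [set: X]) ((w x * mu x)%:E *
    poweR (\esum_(i in [set i | S i x])
      ((mu i)^-1%:E * \esum_(y in S i) (`|f y| * mu y)%:E)) p) <=
  (sector_const alpha p b)%:E * N)%E.
Proof.
apply: (@geometric_family_bound R X X S (fun v x => (lev x - lev v)%N) p lam 4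
  (Kb * Kb `^ (p - 1)) G mu TW TS w mu f) => //.
- by rewrite mulr_gt0 ?powR_gt0.
- move=> v; apply: (sector_geometric T _ TW0 Kb0 _ TW_le) => x.
    by rewrite mulr_gt0.
  by have [] := TWP x.
- move=> v; apply: (sector_geometric T (F := fun x => sig x * mu x) _ TS0 Kb0 _ TS_le) => x.
    by rewrite mulr_gt0.
  by have [] := TSP x.
- by move=> r x r01; exact: (ancestors_geometric T).
Qed.

Lemma psector_family_bound :
  (\esum_(x in [set: X]) ((w x * mu x)%:E *
    poweR (\esum_(i in [set i | psector i x])
      ((child_mass adj o q alpha c i)^-1%:E *
        \esum_(y in psector i) (`|f y| * mu y)%:E)) p) <=
  (psector_const alpha p b)%:E * N)%E.
Proof.
have sum0 (H : X -> R) v : (forall u, 0 < H u) -> 0 < \sum_(u <- ch v) H u.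
  move=> H0; have [u uv] := ex_ch T v; rewrite (bigD1_seq u) ?uniq_ch//=.
  by rewrite ltr_pwDl// sumr_ge0// => z _; exact: ltW.
apply: (@geometric_family_bound R X X psector (fun v x => (lev x - lev v)%N) p lam 4
  (C0 `^ p * (b + 1)) G (child_mass adj o q alpha c) (fun v => \sum_(u <- ch v) TW u)
  (fun v => \sum_(u <- ch v) TS u) w mu f) => //.
- by rewrite mulr_gt0 ?powR_gt0// ltr_wpDl// bge0.
- by move=> v; exact: child_mass_gt0.
- by move=> v; exact: sum0.
- by move=> v; exact: sum0.
- move=> v; apply: (psector_geometric T _ TW0 Kb0 _ TW_le) => // x.
    by rewrite mulr_gt0.
  by have [] := TWP x.
- move=> v; apply: (psector_geometric T (F := fun x => sig x * mu x) _ TS0 Kb0 _ TS_le) => // x.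
    by rewrite mulr_gt0.
  by have [] := TSP x.
- move=> r x r01; apply: le_trans (ancestors_geometric T x r01).
  rewrite esum_mkcond [leRHS]esum_mkcond; apply: le_esum => v _.
  have r0 : 0 <= r by case/andP: r01 => /ltW.
  case: ifPn => [/set_mem[vx _]|_]; first by rewrite ifT//; exact/mem_set.
  by case: ifP => _; rewrite lee_fin ?exprn_ge0.
Qed.

End Weights.

(** * Boundedness of the projector *)

(** Integrating the kernel [\sum_v 1_(Q v) x * 1_(Q v) y / m v] produces the sum of
the averages over the sets containing [x]. *)
Lemma esum_family_kernel (R : realType) (X : choiceType) (Q : X -> set X) (m F : X -> R) x :
  (forall v, 0 < m v) -> (forall y, 0 <= F y) ->
  (\esum_(y in [set: X]) ((F y)%:E *
     \esum_(v in [set v | Q v y]) ((`[< Q v x >])%:R / m v)%:E) =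
   \esum_(v in [set v | Q v x]) ((m v)^-1%:E * \esum_(y in Q v) (F y)%:E))%E.
Proof.
move=> m0 F0.
have a0 v : 0 <= (`[< Q v x >])%:R / m v by rewrite divr_ge0// ltW.
transitivity (\esum_(y in [set: X]) \esum_(v in [set v | Q v y])
    ((F y)%:E * ((`[< Q v x >])%:R / m v)%:E))%E.
  by apply: eq_esum => y _; rewrite ge0_esumZl// => v _; rewrite lee_fin.
rewrite (esum_exchange (fun y v => Q v y)); last first.
  by move=> y v; rewrite -EFinM lee_fin mulr_ge0.
rewrite [RHS]esum_mkcond; apply: eq_esum => v _.
under eq_esum => y _ do rewrite muleC.
rewrite ge0_esumZl//; last by move=> y _; rewrite lee_fin.
case: ifPn => [/set_mem|/negP] vx.
  by rewrite (asboolT vx) mul1r.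
by rewrite asboolF ?mul0r ?mul0e// => vx'; apply: vx; exact/mem_set.
Qed.

Section Projector.
Variables (R : realType) (X : choiceType) (adj : rel X) (o : X) (q : nat -> nat).
Hypothesis T : radial_tree adj o q.
Variables (alpha c : R).
Hypothesis alpha1 : 1 < alpha.
Hypothesis c0 : 0 < c.

Notation S := (sector adj o).
Notation psector := (psector adj o).
Notation mu := (mass adj o q alpha c).
Notation cm := (child_mass adj o q alpha c).

Hypothesis mu1 : measure_of mu [set: X] = 1%E.
Variables (p : R) (w f : X -> R).
Hypothesis p1 : 1 < p.
Hypothesis wBp : Bp adj o mu p w.
Hypothesis fLp : Lp mu p w f.

Let b := fine (Bp_const adj o mu p w).
Let p0 : 0 < p. Proof. by move: p1; lra. Qed.
Let mu0 x : 0 < mu x. Proof. exact: (mass_gt0 T). Qed.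
Let w0 x : 0 < w x. Proof. by case: wBp. Qed.
Let fm0 y : 0 <= `|f y| * mu y. Proof. by rewrite mulr_ge0 ?(ltW (mu0 y)). Qed.

Let N : \bar R := (\esum_(x in [set: X]) (`|f x| `^ p * w x * mu x)%:E)%E.

Let N0 : (0 <= N)%E.
Proof.
apply: esum_ge0 => x _; rewrite lee_fin.
exact: mulr_ge0 (mulr_ge0 (powR_ge0 _ _) (ltW (w0 x))) (ltW (mu0 x)).
Qed.

Let Nfin : (N < +oo)%E.
Proof. by apply: lty_poweRy fLp; rewrite invr_neq0// lt0r_neq0. Qed.

Let A1 x := (\esum_(i in [set i | S i x])
      ((mu i)^-1%:E * \esum_(y in S i) (`|f y| * mu y)%:E))%E.
Let A2 x := (\esum_(i in [set i | psector i x])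
      ((cm i)^-1%:E * \esum_(y in psector i) (`|f y| * mu y)%:E))%E.

Let A10 x : (0 <= A1 x)%E.
Proof.
apply: esum_ge0 => v _; rewrite mule_ge0 ?lee_fin ?invr_ge0 ?(ltW (mu0 v))//.
by apply: esum_ge0 => y _; rewrite lee_fin.
Qed.

Let A20 x : (0 <= A2 x)%E.
Proof.
apply: esum_ge0 => v _; rewrite mule_ge0 ?lee_fin ?invr_ge0 ?(ltW (child_mass_gt0 T _ c0 v))//.
by apply: esum_ge0 => y _; rewrite lee_fin.
Qed.

(** The whole tree is the sector of the origin, so that the bound for averages over
sectors, read at the origin, controls the integral of [f]. *)
Lemma Lp_weight_sub_L1 : Lp mu 1 (fun=> 1) f.
Proof.
apply: poweR_lty.
have h := sector_family_bound T alpha1 c0 p1 wBp f.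
have {h} : ((w o * mu o)%:E * poweR (A1 o) p < +oo)%E.
  apply: (@le_lt_trans _ _ ((sector_const alpha p b)%:E * N)%E).
    apply: le_trans h; exact: (esum_ge_term (A := [set: X]) (i := o)
      (fun x => (w x * mu x)%:E * poweR (A1 x) p)%E I).
  have -> : N = (fine N)%:E by rewrite fineK// ge0_fin_numE.
  by rewrite -EFinM ltry.
have wm : 0 < w o * mu o by rewrite mulr_gt0.
have wf : ((w o * mu o)^-1%:E \is a fin_num) by [].
have wi : (0 <= (w o * mu o)^-1%:E)%E by rewrite lee_fin invr_ge0 ltW.
move=> /(lte_mul_pinfty wi wf); rewrite muleA -EFinM mulVf ?lt0r_neq0// mul1e.
move=> /(lty_poweRy (lt0r_neq0 p0)) A1fin.
have h1 : ((mu o)^-1%:E * (\esum_(y in S o) (`|f y| * mu y)%:E) < +oo)%E.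
  apply: le_lt_trans A1fin.
  apply: (esum_ge_term (A := [set i | S i o])
    (fun i => (mu i)^-1%:E * \esum_(y in S i) (`|f y| * mu y)%:E)%E).
  exact: sector_refl.
have mo : (0 <= (mu o)%:E)%E by rewrite lee_fin ltW.
have mf : ((mu o)%:E \is a fin_num) by [].
have := lte_mul_pinfty mo mf h1.
rewrite muleA -EFinM mulfV ?lt0r_neq0// mul1e (sector_originT T).
move=> h2; apply: le_lt_trans h2; apply: le_esum => y _.
by rewrite lee_fin powRr1// mulr1.
Qed.

Variables (P : (X -> R) -> X -> R).
Hypothesis HP : bergman_projector adj mu P.

Let projector_le x : (`|P f x|%:E <= 4%:E * (A1 x + A2 x))%E.
Proof.
have [K HK PK] := bp_kernel HP.
have Pf := PK f Lp_weight_sub_L1 x.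
rewrite -abse_EFin Pf; apply: (le_trans (abs_ssum_le _ _)).
pose k1 y := (\esum_(v in [set v | S v y]) ((`[< S v x >])%:R / mu v)%:E)%E.
pose k2 y := (\esum_(v in [set v | psector v y]) ((`[< psector v x >])%:R / cm v)%:E)%E.
have k10 y : (0 <= k1 y)%E.
  by apply: esum_ge0 => v _; rewrite lee_fin divr_ge0 ?(ltW (mu0 v)).
have k20 y : (0 <= k2 y)%E.
  by apply: esum_ge0 => v _; rewrite lee_fin divr_ge0 ?(ltW (child_mass_gt0 T _ c0 v)).
apply: (@le_trans _ _ (\esum_(y in [set: X]) (4%:E *
   ((`|f y| * mu y)%:E * k1 y + (`|f y| * mu y)%:E * k2 y)))%E).
  apply: le_esum => y _.
  rewrite -ge0_muleDr// muleCA -mulrA normrM EFinM muleC.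
  rewrite normrM (gtr0_norm (mu0 y)) lee_wpmul2l ?lee_fin//.
  exact: (kernel_bound T c0 mu1 HK).
rewrite ge0_esumZl//; last first.
  by move=> y _; rewrite adde_ge0// mule_ge0// lee_fin.
rewrite esumD; last 2 first.
- by move=> y _; rewrite mule_ge0// lee_fin.
- by move=> y _; rewrite mule_ge0// lee_fin.
rewrite /k1 /k2 !esum_family_kernel//; last by move=> v; exact: child_mass_gt0.
Qed.

Let C := 8 `^ p * (sector_const alpha p b + psector_const alpha p b).

Lemma projector_power_bound :
  (\esum_(x in [set: X]) (`|P f x| `^ p * w x * mu x)%:E <= C%:E * N)%E.
Proof.
have wm x : 0 <= w x * mu x by exact: ltW (mulr_gt0 (w0 x) (mu0 x)).
apply: (@le_trans _ _ (\esum_(x in [set: X]) ((8 `^ p)%:E *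
   ((w x * mu x)%:E * poweR (A1 x) p + (w x * mu x)%:E * poweR (A2 x) p)))%E).
  apply: le_esum => x _.
  rewrite -ge0_muleDr ?poweR_ge0// muleCA -mulrA mulrC EFinM lee_wpmul2l ?lee_fin//.
  rewrite -[(`|P f x| `^ p)%:E]poweR_EFin.
  apply: (@le_trans _ _ (poweR (4%:E * (A1 x + A2 x)) p)).
    apply: gt0_ler_poweR (projector_le x); rewrite ?(ltW p0)// ?in_itv/= ?leey ?andbT ?lee_fin//.
    by rewrite mule_ge0 ?adde_ge0// lee_fin.
  rewrite poweRM ?adde_ge0// ?lee_fin// poweR_EFin.
  apply: (@le_trans _ _ ((4 `^ p)%:E * ((2 `^ p)%:E * (poweR (A1 x) p + poweR (A2 x) p)))%E).
    by rewrite lee_wpmul2l ?lee_fin ?powR_ge0// poweR_addn_le.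
  rewrite muleA -EFinM -powRM// (_ : 4 * 2 = 8 :> R)//.
  by rewrite -natrM.
rewrite ge0_esumZl ?powR_ge0//; last first.
  by move=> x _; rewrite adde_ge0// mule_ge0 ?poweR_ge0// lee_fin.
rewrite /C EFinM -muleA lee_wpmul2l ?lee_fin ?powR_ge0//.
rewrite esumD; last 2 first.
- by move=> x _; rewrite mule_ge0 ?poweR_ge0// lee_fin.
- by move=> x _; rewrite mule_ge0 ?poweR_ge0// lee_fin.
have -> : ((sector_const alpha p b + psector_const alpha p b)%:E * N =
   (sector_const alpha p b)%:E * N + (psector_const alpha p b)%:E * N)%E.
  have -> : N = (fine N)%:E by rewrite fineK// ge0_fin_numE.
  by rewrite -!EFinM -EFinD mulrDl.
apply: leeD; first exact: sector_family_bound.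
exact: psector_family_bound.
Qed.

End Projector.

Theorem theorem2 (R : realType) (X : choiceType) (adj : rel X) (o : X)
    (q : nat -> nat) (htree : radial_tree adj o q)
    (alpha c : R) (halpha : 1 < alpha) (hc : 0 < c)
    (hmu : measure_of (mass adj o q alpha c) [set: X] = 1%E)
    (p : R) (hp : 1 < p) :
  let mu := mass adj o q alpha c in
  exists C : R -> R,
    forall P : (X -> R) -> (X -> R), bergman_projector adj mu P ->
    forall w : X -> R, Bp adj o mu p w ->
    forall f : X -> R, Lp mu p w f ->
      (Lpnorm mu p w (P f) <=
         (C (fine (Bp_const adj o mu p w)))%:E * Lpnorm mu p w f)%E.
Proof.
move=> mu.
(* The absolute value makes the constant nonnegative for every real argument. *)
pose C b := `|8 `^ p * (sector_const alpha p b + psector_const alpha p b)|.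
exists (fun b => C b `^ p^-1) => P HP w wBp f fLp.
have w0 x : 0 <= w x by case: wBp => /(_ x) /ltW.
have mu0 x : 0 <= mu x by exact/ltW/(mass_gt0 htree).
have C0 b : 0 <= C b by exact: normr_ge0.
have sum0 (g : X -> R) : (0 <= \esum_(x in [set: X]) (`|g x| `^ p * w x * mu x)%:E)%E.
  by apply: esum_ge0 => x _; rewrite lee_fin; do 2!apply: mulr_ge0 => //; exact: powR_ge0.
have p0 : 0 <= p^-1 by rewrite invr_ge0; apply: ltW; apply: lt_trans hp.
rewrite /Lpnorm -poweR_EFin -poweRM ?lee_fin//.
apply: gt0_ler_poweR => //; rewrite ?in_itv/= ?leey ?andbT ?mule_ge0 ?lee_fin//.
apply: le_trans (projector_power_bound htree halpha hc hmu hp wBp fLp HP) _.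
by rewrite lee_wpmul2r// lee_fin ler_norm.
Qed.
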